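(* Let $K=5$ and $\theta=0$, and let $\Psi:\mathbb{C}\setminus\mathcal{M}_{5,0}\to\mathbb{C}$ be the map $\Psi(c)=\psi_c(c)$. Then $c=-1/10$ is an orientation reversing parameter, and $\Psi$ has a fold in every connected open subset $U$ of $\mathbb{C}\setminus\mathcal{M}_{5,0}$ which contains both $-1/10$ and a neighbourhood of infinity. In particular, $\Psi$ is not injective on $\mathbb{C}\setminus\mathcal{M}_{5,0}$, and so is not a quasiconformal map there.
   Context: For $K>1$ and $\theta\in(-\pi/2,\pi/2]$ let $h(z)=\frac{K+1}{2}z+e^{2i\theta}\frac{K-1}{2}\overline{z}$ (real-linear stretch by factor $K$ in the direction $e^{i\theta}$; for $\theta=0$, $h(x+iy)=Kx+iy$). For $c\in\mathbb{C}$ let $f_c(z)=h(z)^2+c$, with iterates $f_c^n$. Set $I(f_c)=\{z: f_c^n(z)\to\infty\}$, $BO(f_c)=\mathbb{C}\setminus I(f_c)$, and $\mathcal{M}_{K,\theta}=\{c\in\mathbb{C}:0\in BO(f_c)\}$. Böttcher coordinate $\psi_c$ (known, Fletcher–Fryer): near infinity put $\psi_0=\mathrm{id}$ and $\psi_{k+1}=f_0^{-1}\circ\psi_k\circ f_c$, the branch of $f_0^{-1}$ being chosen so that $\psi_{k+1}(z)=z+o(1)$ as $|z|\to\infty$. The sequence $(\psi_k)$ converges uniformly on a neighbourhood of infinity $U_c$ (which may be taken with $f_c(U_c)\subset U_c$ and $U_c\cup\{\infty\}$ simply connected) to a quasiconformal map $\psi_c$ with $\psi_c\circ f_c=f_0\circ\psi_c$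 on $U_c$. If $c\notin\mathcal{M}_{K,\theta}$ and $n$ is the least integer with $c\in f_c^{-n}(U_c)$, then $\psi_c$ extends, by lifting curves under $f_c$ and $f_0$, to an injective continuous map on $f_c^{-n}(U_c)$ still satisfying $\psi_c\circ f_c=f_0\circ\psi_c$; this extension is uniquely determined by $\psi_c|_{U_c}$ and is again denoted $\psi_c$. Then $\Psi(c):=\psi_c(c)$ for $c\in\mathbb{C}\setminus\mathcal{M}_{K,\theta}$. $\Psi$ is $C^1$ on $\mathbb{C}\setminus\mathcal{M}_{K,\theta}$; $D_c\Psi$ denotes its real ($2\times 2$) derivative. A point $c_0\in\mathbb{C}\setminus\mathcal{M}_{K,\theta}$ is an orientation reversing parameter if $\det D_c\Psi(c_0)<0$. If $U\subset\mathbb{C}\setminus\mathcal{M}_{K,\theta}$ is a connected open set on which $\det D_c\Psi$ takes both signs (positive and negative), $\Psi$ is said to have a fold in $U$. A neighbourhood of infinity is a set containing $\{|c|>R\}$ for some $R<\infty$. *)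

(* Defs.v *)
From Stdlib Require Import Reals.
From Coquelicot Require Import Coquelicot.
Open Scope R_scope.

(** * The family [f_c] and its parameter space *)

Definition h (K theta : R) (z : C) : C :=
  (RtoC ((K + 1) / 2) * z
   + (cos (2 * theta), sin (2 * theta)) * RtoC ((K - 1) / 2) * Cconj z)%C.

Definition f (K theta : R) (c z : C) : C := (h K theta z * h K theta z + c)%C.

Definition iterates (K theta : R) (c : C) (n : nat) (z : C) : C :=
  Nat.iter n (f K theta c) z.

Definition escaping (K theta : R) (c z : C) : Prop :=
  is_lim_seq (fun n => Cmod (iterates K theta c n z)) p_infty.

Definition BO (K theta : R) (c z : C) : Prop := ~ escaping K theta c z.

Definition Mset (K theta : R) (c : C) : Prop := BO K theta c (RtoC 0).

Definition outsideM (K theta : R) (c : C) : Prop := ~ Mset K theta c.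

(** * Subsets of the plane *)

Definition nbhd_infinity (U : C -> Prop) : Prop :=
  exists r : R, forall z : C, Cmod z > r -> U z.

Definition connected (U : C -> Prop) : Prop :=
  forall A B : C -> Prop,
    open A -> open B ->
    (forall z, U z -> A z \/ B z) ->
    (exists z, U z /\ A z) -> (exists z, U z /\ B z) ->
    exists z, U z /\ A z /\ B z.

Definition injective_on (U : C -> Prop) (g : C -> C) : Prop :=
  forall z w, U z -> U w -> g z = g w -> z = w.

(** For open [U] this is continuity of the restriction of [g] to [U]. *)
Definition continuous_on_open (U : C -> Prop) (g : C -> C) : Prop :=
  forall z, U z -> continuous g z.

Definition uniform_limit_on (U : C -> Prop) (g : nat -> C -> C) (l : C -> C) :
  Prop :=
  forall eps : R, 0 < eps ->
    exists N : nat, forall k z, (N <= k)%nat -> U z -> Cmod (g k z - l z)%C < eps.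

(** [g z = z + o(1)] as [|z|] tends to infinity. *)
Definition asymptotic_to_id (g : C -> C) : Prop :=
  forall eps : R, 0 < eps -> nbhd_infinity (fun z => Cmod (g z - z)%C < eps).

(** * The Boettcher coordinate *)

(** The neighbourhood of infinity [U_c].  Since [|h z| >= |z|] for [K >= 1],
    [|z| > 1 + |c|] gives [|f_c z| >= |z|^2 - |c| > |z|], hence
    [f_c(U_c)] is contained in [U_c]; and [U_c] together with infinity is a
    round disc of the Riemann sphere, hence simply connected.  A smaller disc
    about infinity leads to the same extended coordinate at [c]. *)
Definition Unbhd (c z : C) : Prop := Cmod z > 1 + Cmod c.

Definition preim (K theta : R) (c : C) (n : nat) (z : C) : Prop :=
  Unbhd c (iterates K theta c n z).

(** [psi (k+1)] is a continuous branch of [f_0^{-1} o psi k o f_c] on [U_c],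
    normalized by [psi (k+1) z = z + o(1)]. *)
Definition bottcher_sequence (K theta : R) (c : C) (psi : nat -> C -> C) : Prop :=
  (forall z, Unbhd c z -> psi 0%nat z = z) /\
  (forall k z, Unbhd c z ->
     f K theta (RtoC 0) (psi (S k) z) = psi k (f K theta c z)) /\
  (forall k, continuous_on_open (Unbhd c) (psi (S k))) /\
  (forall k, asymptotic_to_id (psi (S k))).

Definition least (P : nat -> Prop) (n : nat) : Prop :=
  P n /\ forall m, P m -> (n <= m)%nat.

(** [psi] restricted to [U_c] is the limit of the sequence above, and on
    [f_c^{-n}(U_c)], with [n] least such that this set contains [c], it is the
    injective continuous extension that still conjugates [f_c] to [f_0].
    Outside that set the values of [psi] are irrelevant. *)
Definition is_bottcher (K theta : R) (c : C) (psi : C -> C) : Prop :=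
  (exists psik : nat -> C -> C,
     bottcher_sequence K theta c psik /\ uniform_limit_on (Unbhd c) psik psi) /\
  (forall n, least (fun m => preim K theta c m c) n ->
     continuous_on_open (preim K theta c n) psi /\
     injective_on (preim K theta c n) psi /\
     forall z, preim K theta c n z ->
       psi (f K theta c z) = f K theta (RtoC 0) (psi z)).

(** * Real derivative, orientation, folds *)

Definition has_real_derivative (Psi : C -> C) (c : C) (L : C -> C) : Prop :=
  @filterdiff R_AbsRing C_R_NormedModule C_R_NormedModule Psi (locally c) L.

(** Determinant of a real-linear map, in the real basis [1, i]. *)
Definition det (L : C -> C) : R :=
  Re (L (RtoC 1)) * Im (L Ci) - Re (L Ci) * Im (L (RtoC 1)).

Definition orientation_reversing (K theta : R) (Psi : C -> C) (c : C) : Prop :=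
  outsideM K theta c /\
  exists L, has_real_derivative Psi c L /\ det L < 0.

Definition has_fold (K theta : R) (Psi : C -> C) (U : C -> Prop) : Prop :=
  open U /\ connected U /\ (forall c, U c -> outsideM K theta c) /\
  (exists c L, U c /\ has_real_derivative Psi c L /\ 0 < det L) /\
  (exists c L, U c /\ has_real_derivative Psi c L /\ det L < 0).

(** * Quasiconformal maps (Ahlfors' analytic definition) *)

(** Lebesgue-null subsets of the line and of the plane. *)
Definition null1 (E : R -> Prop) : Prop :=
  forall eps : R, 0 < eps ->
    exists a b : nat -> R,
      (forall i, a i <= b i) /\
      (forall x, E x -> exists i, a i <= x <= b i) /\
      (forall N, sum_n (fun i => b i - a i) N <= eps).

Definition null2 (E : C -> Prop) : Prop :=
  forall eps : R, 0 < eps ->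
    exists a b a' b' : nat -> R,
      (forall i, a i <= b i /\ a' i <= b' i) /\
      (forall z, E z -> exists i, a i <= Re z <= b i /\ a' i <= Im z <= b' i) /\
      (forall N, sum_n (fun i => (b i - a i) * (b' i - a' i)) N <= eps).

(** The intervals [[s i, t i]], [i <= N], are non-overlapping and listed in
    increasing order. *)
Definition absolutely_continuous (a b : R) (g : R -> C) : Prop :=
  forall eps : R, 0 < eps -> exists delta : R, 0 < delta /\
    forall (N : nat) (s t : nat -> R),
      (forall i, (i <= N)%nat -> a <= s i <= t i /\ t i <= b) ->
      (forall i j, (i < j <= N)%nat -> t i <= s j) ->
      sum_n (fun i => t i - s i) N < delta ->
      sum_n (fun i => Cmod (g (t i) - g (s i))%C) N < eps.

Definition ACL (U : C -> Prop) (g : C -> C) : Prop :=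
  forall a b a' b' : R, a < b -> a' < b' ->
    (forall x y, a <= x <= b -> a' <= y <= b' -> U (x, y)) ->
    null1 (fun y => a' <= y <= b' /\
                    ~ absolutely_continuous a b (fun x => g (x, y))) /\
    null1 (fun x => a <= x <= b /\
                    ~ absolutely_continuous a' b' (fun y => g (x, y))).

(** The partial derivatives of [g] at [z] exist and
    [|g_zbar| <= k |g_z|], where [2 g_zbar = g_x + i g_y] and
    [2 g_z = g_x - i g_y]. *)
Definition dilatation_le (k : R) (g : C -> C) (z : C) : Prop :=
  exists gx gy : C,
    is_derive (V := C_R_NormedModule) (fun x : R => g (x, Im z)) (Re z) gx /\
    is_derive (V := C_R_NormedModule) (fun y : R => g (Re z, y)) (Im z) gy /\
    Cmod (gx + Ci * gy)%C <= k * Cmod (gx - Ci * gy)%C.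

Definition homeomorphic_onto_image (U : C -> Prop) (g : C -> C) : Prop :=
  injective_on U g /\ continuous_on_open U g /\
  forall z, U z -> forall eps : R, 0 < eps -> exists delta : R, 0 < delta /\
    forall w, U w -> Cmod (g w - g z)%C < delta -> Cmod (w - z)%C < eps.

Definition quasiconformal (U : C -> Prop) (g : C -> C) : Prop :=
  open U /\ homeomorphic_onto_image U g /\ ACL U g /\
  exists k : R, 0 <= k < 1 /\ null2 (fun z => U z /\ ~ dilatation_le k g z).

(* Main.v *)
From Stdlib Require Import Reals Ranalysis5 Lra Lia.
From Coquelicot Require Import Coquelicot.
Require Import Defs.
Open Scope R_scope.

(** In real coordinates [f_c (x, y) = (25 x^2 - y^2 + a, 10 x y + b)] with
    [c = (a, b)], and near infinity [|psi_c z - z| <= 1].  Hence the [f_0]-orbit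
    [(u_j, v_j)] of [Psi c] is shadowed by the [f_c]-orbit [(x_j, y_j)] of [c].
    For [c] near a suitable real parameter both orbits escape close to the
    positive real axis, where the two coordinates decouple to first order and
    expand by the factors [50 u_j] and [10 u_j].  So the real derivative of
    [Psi] at real [c] is diagonal, with entries [lim x_j' / (50 u_0 ... 50 u_(j-1))]
    and [lim y_j' / (10 u_0 ... 10 u_(j-1))], where [x_j'] is the derivative of
    [x_j] in [a] and [y_j'] that of [y_j] in [b].  At [c = -1/10] one has
    [x' = 1, -4, -29, ...] and [y' = 1, 0, 1, 5.6, ...], so the determinant is
    negative; at large positive [c] all [x_j'] and [y_j'] are positive.

    For non-injectivity fix [b = 1/1000] and let [a] run through [[-14/100, -13/100]].
    The sets of [a] for which some [y_j > 0], resp. some [y_j < -b], are open,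
    disjoint and nonempty, so some [a] lies in neither of them.  For this [a] the
    sequence [y_j], hence also [v_j], is bounded; as [v_(j+1) = 10 u_j v_j], this
    forces [Psi c] to be real.  The same holds for the conjugate parameter, whose
    orbit has the same real parts, and expansion of [f_0] gives the same value
    of [Psi] there. *)

(** * The Boettcher coordinate near infinity *)

Lemma C_eq (z w : C) : Re z = Re w -> Im z = Im w -> z = w.
Proof. destruct z, w; simpl; congruence. Qed.

Lemma h_eq z : h 5 0 z = (5 * Re z, Im z).
Proof.
  unfold h; rewrite Rmult_0_r, cos_0, sin_0.
  destruct z as [x y]; unfold Re, Im; apply C_eq; simpl; field.
Qed.

Lemma f_Re c z : Re (f 5 0 c z) = 25 * Re z ^ 2 - Im z ^ 2 + Re c.
Proof. unfold f; rewrite h_eq; destruct z, c; simpl; ring. Qed.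

Lemma f_Im c z : Im (f 5 0 c z) = 10 * Re z * Im z + Im c.
Proof. unfold f; rewrite h_eq; destruct z, c; simpl; ring. Qed.

Lemma Cmod_sqr z : Cmod z ^ 2 = Re z ^ 2 + Im z ^ 2.
Proof. exact (Cmod2_alt z). Qed.

Lemma Cmod_le_Re_Im z : Cmod z <= Rabs (Re z) + Rabs (Im z).
Proof.
  pose proof (Cmod_sqr z); pose proof (Cmod_ge_0 z).
  pose proof (Rabs_pos (Re z)); pose proof (Rabs_pos (Im z)).
  pose proof (pow2_abs (Re z)); pose proof (pow2_abs (Im z)). nra.
Qed.

Lemma Im_le_Cmod z : Rabs (Im z) <= Cmod z.
Proof.
  pose proof (Cmod_sqr z); pose proof (Cmod_ge_0 z).
  pose proof (Rabs_pos (Im z)); pose proof (pow2_abs (Im z)).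
  pose proof (pow2_ge_0 (Re z)). nra.
Qed.

Lemma Cmod_h_ge z : Cmod z <= Cmod (h 5 0 z).
Proof.
  pose proof (Cmod_sqr z); pose proof (Cmod_sqr (h 5 0 z)) as H0.
  rewrite h_eq in H0 |- *; cbn [Re Im fst snd] in H0.
  pose proof (Cmod_ge_0 z); pose proof (Cmod_ge_0 (5 * Re z, Im z)).
  pose proof (pow2_ge_0 (Re z)). nra.
Qed.

(** [h] is real-linear, so this is a difference of squares. Together with [Cmod_h_ge] it turns
    closeness of the squares into a bound on [|z - w| |z + w|]. *)
Lemma h_sqr_sub z w :
  (h 5 0 z * h 5 0 z - h 5 0 w * h 5 0 w = h 5 0 (z - w) * h 5 0 (z + w))%C.
Proof. rewrite !h_eq; destruct z, w; apply C_eq; simpl; ring. Qed.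

Lemma Cmod_f_ge c z : Cmod z ^ 2 - Cmod c <= Cmod (f 5 0 c z).
Proof.
  unfold f; set (u := h 5 0 z).
  assert (Cmod (u * u)%C <= Cmod (u * u + c)%C + Cmod c).
  { replace (u * u)%C with ((u * u + c) + (- c))%C at 1 by ring.
    rewrite <- (Cmod_opp c); apply Cmod_triangle. }
  rewrite Cmod_mult in H.
  pose proof (Cmod_h_ge z) as H0; fold u in H0; pose proof (Cmod_ge_0 z). nra.
Qed.

Lemma Unbhd_growth c z : Unbhd c z ->
  1 + Cmod c < Cmod z /\ Cmod z + Cmod c * (Cmod z - 1) <= Cmod (f 5 0 c z).
Proof.
  unfold Unbhd; intros H; split; [lra|].
  pose proof (Cmod_f_ge c z); pose proof (Cmod_ge_0 c). nra.
Qed.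

Lemma Unbhd_forward c z : Unbhd c z -> Unbhd c (f 5 0 c z).
Proof.
  intros H; destruct (Unbhd_growth c z H); pose proof (Cmod_ge_0 c).
  unfold Unbhd in *. nra.
Qed.

(** Intermediate value theorem on [[a, T]]. It settles choices of sign below: the sign is known far
    out on a ray and is carried back to its start. *)
Lemma positive_along_ray (g : R -> R) (a T : R) :
  (forall t, a <= t -> continuous g t) -> (forall t, a <= t -> g t <> 0) ->
  a <= T -> 0 < g T -> 0 < g a.
Proof.
  intros Hc Hn HT Hg.
  destruct (Rtotal_order (g a) 0) as [H|[H|H]]; [|now destruct (Hn a (Rle_refl a))|exact H].
  destruct (Rle_lt_or_eq_dec _ _ HT) as [HT'|<-]; [|lra].
  destruct (IVT_interv g a T) as [z [Hz1 Hz2]]; try assumption.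
  - intros t Ht; apply continuity_pt_filterlim, Hc; tauto.
  - now destruct (Hn z (proj1 Hz1)).
Qed.

Lemma continuous_Cmod (g : R -> C) t :
  continuous g t -> continuous (fun s => Cmod (g s)) t.
Proof.
  intros Hg; unfold Cmod.
  apply (continuous_comp (fun s => (fst (g s) ^ 2 + snd (g s) ^ 2)) sqrt).
  2: apply continuous_sqrt.
  assert (H1 : continuous (fun s => fst (g s)) t)
    by (apply (continuous_comp g fst); [assumption|apply continuous_fst]).
  assert (H2 : continuous (fun s => snd (g s)) t)
    by (apply (continuous_comp g snd); [assumption|apply continuous_snd]).
  simpl; apply (continuous_plus (V := R_NormedModule));
   repeat apply (continuous_mult (K := R_AbsRing)); try assumption; apply continuous_const.
Qed.

Lemma continuous_C {T : UniformSpace} (g k : T -> R) t :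
  continuous g t -> continuous k t -> continuous (fun s => (g s, k s) : C) t.
Proof.
  intros Hg Hk; apply filterlim_locally; intros eps.
  pose proof (proj1 (filterlim_locally g (g t)) Hg eps) as H1.
  pose proof (proj1 (filterlim_locally k (k t)) Hk eps) as H2.
  generalize (filter_and _ _ H1 H2); apply filter_imp; intros s Hs; exact Hs.
Qed.

(* The branch of the square root is decided by comparing the distances of
   [p z] to [z] and to [-z]: they are never equal, so the comparison is the same
   along the whole ray through [z]. *)
Lemma branch_close_to_id (c : C) (g p : C -> C) :
  (forall z, Unbhd c z -> Cmod (g z - z)%C <= 1) ->
  (forall z, Unbhd c z -> f 5 0 (RtoC 0) (p z) = g (f 5 0 c z)) ->
  continuous_on_open (Unbhd c) p -> asymptotic_to_id p ->
  forall z, Unbhd c z -> Cmod (p z - z)%C <= 1.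
Proof.
  intros Hg Hp Hcont Has.
  (* Since [f_0 (p w) = g (f_c w)] and [h w * h w = f_c w - c], the factored difference of squares
     equals [g (f_c w) - f_c w + c]. *)
  assert (Hprod : forall w, Unbhd c w ->
            Cmod (p w - w)%C * Cmod (p w + w)%C <= 1 + Cmod c).
  { intros w Hw.
    assert (E : (h 5 0 (p w - w) * h 5 0 (p w + w)
                 = (g (f 5 0 c w) - f 5 0 c w) + c)%C).
    { rewrite <- h_sqr_sub, <- Hp by assumption. unfold f. ring. }
    assert (Cmod (h 5 0 (p w - w) * h 5 0 (p w + w))%C <= 1 + Cmod c).
    { rewrite E. eapply Rle_trans; [apply Cmod_triangle|].
      pose proof (Hg _ (Unbhd_forward _ _ Hw)). lra. }
    rewrite Cmod_mult in H.
    pose proof (Cmod_h_ge (p w - w)%C); pose proof (Cmod_h_ge (p w + w)%C).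
    pose proof (Cmod_ge_0 (p w - w)%C); pose proof (Cmod_ge_0 (p w + w)%C). nra. }
  assert (Hsum : forall w, 2 * Cmod w <= Cmod (p w - w)%C + Cmod (p w + w)%C).
  { intros w. rewrite <- (Cmod_opp (p w - w)%C).
    eapply Rle_trans; [|apply Cmod_triangle].
    replace (- (p w - w) + (p w + w))%C with (RtoC 2 * w)%C by ring.
    rewrite Cmod_mult, Cmod_R, Rabs_pos_eq by lra. lra. }
  intros z Hz.
  set (ray := fun t : R => (t * Re z, t * Im z) : C).
  set (d := fun t : R => Cmod (p (ray t) + (ray t))%C
                       - Cmod (p (ray t) - (ray t))%C).
  pose proof (Cmod_ge_0 c) as Hc0.
  assert (Hmod : forall t, 1 <= t -> Cmod (ray t) = t * Cmod z).
  { intros t Ht. replace (ray t) with (RtoC t * z)%C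
      by (unfold ray; apply C_eq; destruct z; simpl; ring).
    rewrite Cmod_mult, Cmod_R, Rabs_pos_eq by lra. reflexivity. }
  assert (Hin : forall t, 1 <= t -> Unbhd c (ray t)).
  { intros t Ht. unfold Unbhd in *. rewrite Hmod by assumption. nra. }
  assert (Hd : 0 < d 1).
  { destruct (Has 1 Rlt_0_1) as [r Hr].
    apply (positive_along_ray d 1 (1 + Rabs r)).
    - intros t Ht. unfold d.
      assert (Hl : continuous ray t).
      { apply continuous_C; apply (continuous_mult (K := R_AbsRing));
          try apply continuous_id; apply continuous_const. }
      assert (Hpl : continuous (fun s : R => p (ray s)) t).
      { apply (continuous_comp ray p); auto. }
      apply (continuous_minus (V := R_NormedModule)); apply continuous_Cmod.
      + apply (continuous_plus (V := C_R_NormedModule)); assumption.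
      + apply (continuous_minus (V := C_R_NormedModule)); assumption.
    - intros t Ht. unfold d.
      pose proof (Hin t Ht) as Hu.
      pose proof (Hprod _ Hu) as H1; pose proof (Hsum (ray t)) as H2.
      unfold Unbhd in Hu. intros H3.
      set (w := (ray t) : C) in *. nra.
    - pose proof (Rabs_pos r); lra.
    - unfold d. set (t := 1 + Rabs r).
      assert (Ht : 1 <= t) by (unfold t; pose proof (Rabs_pos r); lra).
      pose proof (Hin t Ht) as Hu.
      assert (H1 : Cmod (ray t) > r).
      { rewrite Hmod by assumption. unfold Unbhd in Hz.
        pose proof (Rle_abs r). unfold t in *. nra. }
      pose proof (Hr _ H1) as H2; pose proof (Hsum (ray t)) as H3.
      unfold Unbhd in Hu.
      set (w := (ray t) : C) in *. lra. }
  unfold d in Hd.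
  replace (ray 1) with z in Hd by (unfold ray; apply C_eq; simpl; ring).
  (* Now [|p z + z|] is the larger of the two distances, hence at least [|z| > 1 + |c|], and the
     product bound leaves at most 1 for [|p z - z|]. *)
  pose proof (Hprod z Hz); pose proof (Hsum z); unfold Unbhd in Hz.
  pose proof (Cmod_ge_0 (p z - z)%C). nra.
Qed.

(** The bound is trivial for [psi_0 = id], passes from each [psi_k] to the next by
    [branch_close_to_id], and survives in the limit. *)
Lemma bottcher_close_to_id (c : C) (psi : C -> C) :
  is_bottcher 5 0 c psi -> forall z, Unbhd c z -> Cmod (psi z - z)%C <= 1.
Proof.
  intros [[psik [[H0 [Hf [Hc Ha]]] Hlim]] _] z Hz.
  assert (Hk : forall k w, Unbhd c w -> Cmod (psik k w - w)%C <= 1).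
  { induction k as [|k IH].
    - intros w Hw. rewrite H0 by assumption.
      replace (w - w)%C with (RtoC 0) by ring. rewrite Cmod_0; lra.
    - apply (branch_close_to_id c (psik k)); auto. }
  apply Rnot_lt_le; intros H.
  destruct (Hlim (Cmod (psi z - z)%C - 1)) as [N HN]; [lra|].
  pose proof (HN N z (le_n N) Hz) as H1; pose proof (Hk N z Hz) as H2.
  assert (Cmod (psi z - z)%C <= Cmod (psik N z - psi z)%C + Cmod (psik N z - z)%C).
  { rewrite <- (Cmod_opp (psik N z - psi z)%C).
    eapply Rle_trans; [|apply Cmod_triangle].
    apply Req_le; f_equal; ring. }
  lra.
Qed.

(** * Orbits near the positive real axis *)

Definition sector (x : R) (z : C) : Prop :=
  x <= Re z /\ Rabs (Im z) <= Re z / 10.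

(* The slope [1/10] is preserved because [f_0] contracts slopes near the real
   axis by the factor [2/5]; [2499/100] is [25 - (1/10)^2]. *)
Fixpoint good (c : C) (m : nat) (x : R) : Prop :=
  match m with
  | O => 1 + Cmod c < x
  | S m => 0 < x /\ Rabs (Im c) <= (1499 / 100 * x ^ 2 + Re c) / 10 /\
           good c m (2499 / 100 * x ^ 2 + Re c)
  end.

(** In the sector [|10 Re z Im z| <= Re z ^ 2]. Slope [1/10] for the image thus needs [|Im c|] to be
    at most a tenth of [(2499/100 - 10) x ^ 2 + Re c]; this is the origin of [1499/100]. *)
Lemma sector_step c x z : 0 < x -> Rabs (Im c) <= (1499 / 100 * x ^ 2 + Re c) / 10 ->
  sector x z -> sector (2499 / 100 * x ^ 2 + Re c) (f 5 0 c z).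
Proof.
  intros Hx Hc [H1 H2]; unfold sector; rewrite f_Re, f_Im.
  apply Rabs_le_between in Hc, H2.
  assert (x ^ 2 <= Re z ^ 2) by nra.
  assert (Im z ^ 2 <= Re z ^ 2 / 100) by nra.
  split; [lra|].
  apply Rabs_le_between; split; nra.
Qed.

Lemma iterates_S c k z : iterates 5 0 c (S k) z = f 5 0 c (iterates 5 0 c k z).
Proof. reflexivity. Qed.

Lemma iterates_S_r c k z : iterates 5 0 c (S k) z = iterates 5 0 c k (f 5 0 c z).
Proof. unfold iterates; apply Nat.iter_succ_r. Qed.

Lemma iterates_add c j k z :
  iterates 5 0 c (j + k) z = iterates 5 0 c j (iterates 5 0 c k z).
Proof. unfold iterates; apply Nat.iter_add. Qed.

Lemma sector_iterates c m x z : good c m x -> sector x z ->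
  exists X, 1 + Cmod c < X /\ sector X (iterates 5 0 c m z).
Proof.
  revert x z; induction m as [|m IH]; intros x z.
  - simpl; intros H1 H2; exists x; auto.
  - intros (H1 & H2 & H3) H4. rewrite iterates_S_r.
    eapply IH; [exact H3|]. apply sector_step; assumption.
Qed.

Lemma Re_Unbhd c z : 1 + Cmod c < Re z -> Unbhd c z.
Proof.
  unfold Unbhd; intros H; pose proof (re_le_Cmod z); pose proof (Rle_abs (Re z)); lra.
Qed.

Lemma Unbhd_iterates c k z : Unbhd c z -> Unbhd c (iterates 5 0 c k z).
Proof.
  intros H; induction k as [|k IH]; [exact H|].
  rewrite iterates_S; apply Unbhd_forward, IH.
Qed.

Lemma preim_sector c m n x z : (m <= n)%nat -> good c m x -> sector x z ->
  preim 5 0 c n z.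
Proof.
  intros Hmn Hg Hz. destruct (sector_iterates c m x z Hg Hz) as (X & HX & [H1 _]).
  unfold preim. replace n with ((n - m) + m)%nat by lia. rewrite iterates_add.
  apply Unbhd_iterates, Re_Unbhd. lra.
Qed.

Lemma continuous_Re_C (g : R -> C) t : continuous g t -> continuous (fun s => Re (g s)) t.
Proof. intros H; apply (continuous_comp g fst); [assumption|apply continuous_fst]. Qed.

(** * Sign and oddness of the extended coordinate *)

Section Bottcher.
Variables (c : C) (psi : C -> C) (n : nat).
Hypothesis Hpsi : is_bottcher 5 0 c psi.
Hypothesis Hn : least (fun m => preim 5 0 c m c) n.

(* On the horizontal ray from [z], the real part of [psi] cannot vanish since
   [f_0] maps the imaginary axis to the negative axis. *)
Lemma bottcher_Re_pos m x z : (m <= n)%nat -> good c m x -> sector x z ->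
  0 < Re (psi z).
Proof.
  destruct (proj2 Hpsi n Hn) as (Hcont & Hinj & Hconj).
  revert x z; induction m as [|m IH]; intros x z Hmn Hg Hz.
  - destruct Hz as [Hz _]; simpl in Hg.
    assert (Hu : Unbhd c z) by (apply Re_Unbhd; lra).
    pose proof (bottcher_close_to_id c psi Hpsi z Hu) as H.
    pose proof (re_le_Cmod (psi z - z)%C) as H1. pose proof (Cmod_ge_0 c).
    replace (Re (psi z - z)%C) with (Re (psi z) - Re z) in H1
      by (destruct (psi z), z; simpl; ring).
    pose proof (Rle_trans _ _ _ H1 H) as H2. apply Rabs_le_between in H2. lra.
  - set (ray := fun t : R => (Re z + t, Im z) : C).
    assert (Hray : forall t, 0 <= t -> sector x (ray t)).
    { intros t Ht; destruct Hz; split; unfold ray, Re, Im in *; simpl; lra. }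
    replace z with (ray 0) by (unfold ray; apply C_eq; simpl; ring).
    (* The far end of the ray has real part at least [2 + |c|], so it lies in [U_c], where [psi]
       moves points by at most 1. *)
    apply (positive_along_ray (fun t => Re (psi (ray t))) 0 (2 + Cmod c + Rabs (Re z))).
    + intros t Ht. apply continuous_Re_C, (continuous_comp ray psi).
      * apply continuous_C; [|apply continuous_const].
        apply (continuous_plus (V := R_NormedModule));
          [apply continuous_const|apply continuous_id].
      * apply Hcont, (preim_sector c (S m) n x); auto.
    + intros t Ht H0.
      pose proof (Hconj _ (preim_sector c (S m) n x _ Hmn Hg (Hray t Ht))) as H1.
      destruct Hg as (Hg1 & Hg2 & Hg3).
      assert (H2 : 0 < Re (psi (f 5 0 c (ray t)))).
      { eapply (IH _ _ ltac:(lia) Hg3). apply sector_step; auto. }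
      rewrite H1, f_Re, H0 in H2. change (Re (RtoC 0)) with 0 in H2.
      pose proof (pow2_ge_0 (Im (psi (ray t)))). lra.
    + pose proof (Cmod_ge_0 c); pose proof (Rabs_pos (Re z)); lra.
    + set (w := ray _).
      assert (Hw : 2 + Cmod c <= Re w).
      { unfold w, ray; simpl. pose proof (Rle_abs (- Re z)).
        rewrite Rabs_Ropp in H. lra. }
      pose proof (bottcher_close_to_id c psi Hpsi w (Re_Unbhd c w ltac:(lra))) as H.
      pose proof (re_le_Cmod (psi w - w)%C) as H1. pose proof (Cmod_ge_0 c).
      replace (Re (psi w - w)%C) with (Re (psi w) - Re w) in H1
        by (destruct (psi w), w; simpl; ring).
      pose proof (Rle_trans _ _ _ H1 H) as H2. apply Rabs_le_between in H2. lra.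
Qed.

Lemma f_opp z : f 5 0 c (- z)%C = f 5 0 c z.
Proof. apply C_eq; rewrite ?f_Re, ?f_Im; destruct z; simpl; ring. Qed.

(** [f_c] is even, so [psi z] and [psi (- z)] have the same image under [f_0] and agree up to sign.
    The sign is minus, because [psi] is injective and [z] differs from [- z]. *)
Lemma bottcher_odd z : z <> RtoC 0 -> preim 5 0 c n z -> preim 5 0 c n (- z)%C ->
  psi (- z)%C = (- psi z)%C.
Proof.
  intros Hz0 Hz Hz'.
  destruct (proj2 Hpsi n Hn) as (Hcont & Hinj & Hconj).
  pose proof (Hconj _ Hz) as H1; pose proof (Hconj _ Hz') as H2.
  rewrite f_opp, H1 in H2. unfold f in H2.
  assert (H3 : (h 5 0 (psi z - psi (- z)) * h 5 0 (psi z + psi (- z)) = 0)%C).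
  { rewrite <- h_sqr_sub.
    set (u := (h 5 0 (psi z) * h 5 0 (psi z))%C) in *.
    set (v := (h 5 0 (psi (- z)) * h 5 0 (psi (- z)))%C) in *.
    replace u with (u + 0 - 0)%C by ring. rewrite H2. ring. }
  assert (H4 : Cmod (psi z - psi (- z))%C * Cmod (psi z + psi (- z))%C <= 0).
  { apply (f_equal Cmod) in H3. rewrite Cmod_mult, Cmod_0 in H3.
    pose proof (Cmod_h_ge (psi z - psi (- z))%C); pose proof (Cmod_h_ge (psi z + psi (- z))%C).
    pose proof (Cmod_ge_0 (psi z - psi (- z))%C); pose proof (Cmod_ge_0 (psi z + psi (- z))%C).
    nra. }
  assert (H5 : Cmod (psi z - psi (- z))%C = 0 \/ Cmod (psi z + psi (- z))%C = 0).
  { pose proof (Cmod_ge_0 (psi z - psi (- z))%C); pose proof (Cmod_ge_0 (psi z + psi (- z))%C).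
    apply Rmult_integral. nra. }
  destruct H5 as [H5|H5]; apply Cmod_eq_0 in H5.
  - exfalso; apply Hz0.
    assert (E : z = (- z)%C).
    { apply Hinj; auto.
      replace (psi z) with ((psi z - psi (- z)) + psi (- z))%C by ring. rewrite H5; ring. }
    apply C_eq; [apply (f_equal Re) in E|apply (f_equal Im) in E];
      destruct z; simpl in *; lra.
  - replace (psi (- z)%C) with ((psi z + psi (- z)) - psi z)%C by ring. rewrite H5; ring.
Qed.

End Bottcher.

(** * Escape of the critical value and its image under the coordinate *)

Definition orbit (c : C) (j : nat) : C := iterates 5 0 c j c.

(* For [sigma = -1] the parameter itself lies in the left half-plane, and one
   works with [-c], which has the same image under [f_c]. *)
Definition admissible (sigma : R) (n : nat) (c : C) : Prop :=
  (sigma = 1 \/ sigma = -1) /\ (1 <= n)%nat /\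
  (exists x, 0 < x /\ sector x (RtoC sigma * c)%C /\ good c n x) /\
  (forall j, (j < n)%nat -> Cmod (orbit c j) <= 1 + Cmod c).

Lemma f_sigma sigma c z : sigma = 1 \/ sigma = -1 ->
  f 5 0 c (RtoC sigma * z)%C = f 5 0 c z.
Proof.
  intros [->| ->]; apply C_eq; rewrite ?f_Re, ?f_Im; destruct z; simpl; ring.
Qed.

Section Admissible.
Variables (sigma : R) (n : nat) (c : C).
Hypothesis Hc : admissible sigma n c.

(** [c] and [sigma * c] have the same image under [f_c], so [sigma] disappears after the first
    step. *)
Lemma orbit_sector j : (1 <= j <= n)%nat ->
  exists x, sector x (orbit c j) /\ good c (n - j) x.
Proof.
  intros [Hj Hjn]. destruct Hc as (Hs & Hn & (x0 & Hx0 & Hsec & Hg) & _).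
  induction j as [|j IH]; [lia|].
  destruct (Nat.eq_dec j 0) as [->|Hj0].
  - replace n with (S (n - 1)) in Hg by lia. destruct Hg as (H1 & H2 & H3).
    exists (2499 / 100 * x0 ^ 2 + Re c). split; [|exact H3].
    change (orbit c 1) with (f 5 0 c c). rewrite <- (f_sigma sigma) by assumption.
    now apply sector_step.
  - destruct IH as (x & Hx & Hgx); [lia|lia|].
    replace (n - j)%nat with (S (n - S j)) in Hgx by lia.
    destruct Hgx as (H1 & H2 & H3).
    exists (2499 / 100 * x ^ 2 + Re c). split; [|exact H3].
    change (orbit c (S j)) with (f 5 0 c (orbit c j)). now apply sector_step.
Qed.

(** Once [x > 1 + |c|], one has [|Re c| < x <= x ^ 2], so the bound of [sector_step] exceeds
    [(2499/100 - 1) x ^ 2 >= 23 x]. *)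
Lemma orbit_tail_sector k :
  exists x, sector x (orbit c (n + k)) /\ 23 ^ k * (1 + Cmod c) < x.
Proof.
  pose proof (Cmod_ge_0 c) as H0.
  pose proof (re_le_Cmod c) as H1; apply Rabs_le_between in H1.
  pose proof (Im_le_Cmod c) as H2.
  induction k as [|k IH].
  - destruct (orbit_sector n) as (x & Hx & Hg).
    { destruct Hc as (_ & Hn & _); lia. }
    rewrite Nat.sub_diag in Hg. rewrite Nat.add_0_r. simpl in *. exists x; split; [auto|lra].
  - destruct IH as (x & Hx & Hg).
    assert (H3 : 1 <= 23 ^ k) by (apply pow_R1_Rle; lra).
    assert (H4 : 1 + Cmod c < x) by nra.
    exists (2499 / 100 * x ^ 2 + Re c). split.
    + replace (n + S k)%nat with (S (n + k)) by lia.
      change (orbit c (S (n + k))) with (f 5 0 c (orbit c (n + k))).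
      apply sector_step; try assumption; nra.
    + simpl. nra.
Qed.

Lemma orbit_Re_ge k : 23 ^ k * (1 + Cmod c) < Re (orbit c (n + k)).
Proof. destruct (orbit_tail_sector k) as (x & [H _] & H'). lra. Qed.

Lemma orbit_Im_le k : Rabs (Im (orbit c (n + k))) <= Re (orbit c (n + k)) / 10.
Proof. destruct (orbit_tail_sector k) as (x & [_ H] & _). exact H. Qed.

Lemma orbit_Unbhd k : Unbhd c (orbit c (n + k)).
Proof.
  apply Re_Unbhd. pose proof (orbit_Re_ge k). pose proof (Cmod_ge_0 c).
  assert (1 <= 23 ^ k) by (apply pow_R1_Rle; lra). nra.
Qed.

Lemma pow_ge_INR (q : R) k : 2 <= q -> INR k <= q ^ k.
Proof.
  intros Hq; induction k as [|k IH]; [simpl; lra|].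
  rewrite S_INR; simpl. assert (1 <= q ^ k) by (apply pow_R1_Rle; lra). nra.
Qed.

Lemma admissible_outsideM : outsideM 5 0 c.
Proof.
  intros HM; apply HM. unfold escaping.
  (* One step leads from 0 to [c], and [n] more lead into [U_c]. *)
  apply (is_lim_seq_incr_n _ (S n)).
  apply is_lim_seq_le_p_loc with (fun k => INR k); [|apply is_lim_seq_INR].
  exists 0%nat; intros k _.
  replace (k + S n)%nat with (S (n + k)) by lia. rewrite iterates_S_r.
  replace (f 5 0 c (RtoC 0)) with c
    by (apply C_eq; rewrite ?f_Re, ?f_Im; simpl; ring).
  change (INR k <= Cmod (orbit c (n + k))).
  pose proof (orbit_Re_ge k). pose proof (re_le_Cmod (orbit c (n + k))).
  pose proof (Rle_abs (Re (orbit c (n + k)))).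
  pose proof (pow_ge_INR 23 k ltac:(lra)). pose proof (Cmod_ge_0 c).
  assert (1 <= 23 ^ k) by (apply pow_R1_Rle; lra). nra.
Qed.

Lemma admissible_least : least (fun m => preim 5 0 c m c) n.
Proof.
  split.
  - pose proof (orbit_Unbhd 0) as H. rewrite Nat.add_0_r in H. exact H.
  - intros m Hm. destruct (Nat.le_gt_cases n m) as [H|H]; [exact H|].
    destruct Hc as (_ & _ & _ & Hb). pose proof (Hb m H) as H1.
    unfold preim, Unbhd in Hm. unfold orbit in H1. lra.
Qed.

Lemma orbit_preim j : preim 5 0 c n (orbit c j).
Proof.
  unfold preim, orbit. rewrite <- iterates_add. apply orbit_Unbhd.
Qed.

Variable psi : C -> C.
Hypothesis Hpsi : is_bottcher 5 0 c psi.

Lemma shadow_step j : psi (orbit c (S j)) = f 5 0 (RtoC 0) (psi (orbit c j)).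
Proof.
  destruct (proj2 Hpsi n admissible_least) as (_ & _ & Hconj).
  apply Hconj, orbit_preim.
Qed.

Lemma shadow_close k : Cmod (psi (orbit c (n + k)) - orbit c (n + k))%C <= 1.
Proof. apply (bottcher_close_to_id c psi Hpsi), orbit_Unbhd. Qed.

Lemma shadow_Re_pos j : 0 < Re (psi (orbit c (S j))).
Proof.
  destruct (Nat.le_gt_cases n (S j)) as [H|H].
  - replace (S j) with (n + (S j - n))%nat by lia.
    destruct (orbit_tail_sector (S j - n)) as (x & Hx & Hg).
    apply (bottcher_Re_pos c psi n Hpsi admissible_least 0 x); [lia| |exact Hx].
    simpl. assert (1 <= 23 ^ (S j - n)) by (apply pow_R1_Rle; lra).
    pose proof (Cmod_ge_0 c). nra.
  - destruct (orbit_sector (S j)) as (x & Hx & Hg); [lia|].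
    apply (bottcher_Re_pos c psi n Hpsi admissible_least (n - S j) x); auto; lia.
Qed.

(** For [sigma = -1] positivity is known at [- c], which lies in the sector, and oddness of [psi]
    carries it over to [c]. *)
Lemma shadow_Re_0 : 0 < sigma * Re (psi c).
Proof.
  pose proof Hc as (Hs & Hn & (x & Hx & Hsec & Hg) & _).
  pose proof (bottcher_Re_pos c psi n Hpsi admissible_least n x _ (le_n n) Hg Hsec) as H.
  pose proof (preim_sector c n n x _ (le_n n) Hg Hsec) as H1.
  destruct Hs as [E1|E1]; rewrite E1 in H, H1, Hsec |- *.
  - replace (RtoC 1 * c)%C with c in H by ring. lra.
  - replace (RtoC (-1) * c)%C with (- c)%C in * by (apply C_eq; destruct c; simpl; ring).
    rewrite (bottcher_odd c psi n Hpsi admissible_least) in H; auto.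
    + destruct (psi c); simpl in *; lra.
    + intros E. destruct Hsec as [H2 _]. rewrite E in H2. simpl in H2. lra.
    + exact (orbit_preim 0).
Qed.

End Admissible.

(** * Shadowing estimates *)

Lemma half_pow_pos k : 0 < (1 / 2) ^ k.
Proof. apply pow_lt; lra. Qed.

Lemma half_pow_le_1 k : (1 / 2) ^ k <= 1.
Proof. apply Rle_trans with (1 ^ k); [apply pow_incr; lra|rewrite pow1; lra]. Qed.

Lemma half_pow_add j k : (1 / 2) ^ (k + j) <= (1 / 2) ^ k.
Proof.
  rewrite pow_add. pose proof (half_pow_pos k); pose proof (half_pow_le_1 j).
  pose proof (half_pow_pos j). nra.
Qed.

(** Limits along an orbit enter the estimates below as inequalities with an error of order [2^-j],
    which is discarded here. *)
Lemma Rle_of_half_pow x y C : (forall j, x <= y + C * (1 / 2) ^ j) -> x <= y.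
Proof.
  intros H. apply (is_lim_seq_le (fun _ => x) (fun j => y + C * (1 / 2) ^ j) x y).
  - exact H.
  - apply is_lim_seq_const.
  - replace (Finite y) with (Finite (y + C * 0)) by (f_equal; ring).
    apply is_lim_seq_plus'; [apply is_lim_seq_const|].
    apply is_lim_seq_mult'; [apply is_lim_seq_const|].
    apply is_lim_seq_geom. rewrite Rabs_pos_eq; lra.
Qed.

(** * Recursions that differ from the identity by geometrically small terms *)

Section Perturbed.
Variables (a al be : nat -> R) (K B : R).
Hypothesis Ha : forall k, a (S k) = (1 + al k) * a k + be k.
Hypothesis HK : 0 <= K <= 1 / 4.
Hypothesis HB : 0 <= B.
Hypothesis Hal : forall k, Rabs (al k) <= K * (1 / 2) ^ k.
Hypothesis Hbe : forall k, Rabs (be k) <= B * (1 / 2) ^ k.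

(** The induction carries [(2 - t) (|a 0| + 2 B (1 - t))] with [t = 2^-k]. The first factor absorbs
    [1 + al k], since [(1 + t/4) (2 - t) <= 2 - t/2]; the second absorbs [be k]. *)
Lemma perturbed_bounded k : Rabs (a k) <= 2 * (Rabs (a 0%nat) + 2 * B).
Proof.
  assert (H : Rabs (a k) <= (2 - (1 / 2) ^ k) * (Rabs (a 0%nat) + 2 * B * (1 - (1 / 2) ^ k))).
  { induction k as [|k IH].
    - cbn [pow]. lra.
    - rewrite Ha. eapply Rle_trans; [apply Rabs_triang|]. rewrite Rabs_mult.
      assert (H1 : Rabs (1 + al k) <= 1 + 1 / 4 * (1 / 2) ^ k).
      { eapply Rle_trans; [apply Rabs_triang|]. rewrite Rabs_R1.
        pose proof (Hal k); pose proof (half_pow_pos k). nra. }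
      pose proof (Hbe k) as H2; pose proof (half_pow_pos k) as H3;
        pose proof (half_pow_le_1 k) as H4.
      simpl. set (t := (1 / 2) ^ k) in *.
      pose proof (Rabs_pos (a 0%nat)) as H5; pose proof (Rabs_pos (1 + al k)) as H6.
      pose proof (Rabs_pos (a k)) as H7.
      set (A0 := Rabs (a 0%nat)) in *. set (A := Rabs (a k)) in *.
      set (E := Rabs (1 + al k)) in *.
      assert (H8 : E * A <= (1 + 1 / 4 * t) * ((2 - t) * (A0 + 2 * B * (1 - t)))).
      { apply Rmult_le_compat; assumption. }
      assert (H9 : (1 + 1 / 4 * t) * (2 - t) <= 2 - 1 / 2 * t) by nra.
      assert (H10 : 0 <= A0 + 2 * B * (1 - t)) by nra.
      assert (H11 : E * A <= (2 - 1 / 2 * t) * (A0 + 2 * B * (1 - t))).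
      { eapply Rle_trans; [exact H8|]. rewrite <- Rmult_assoc.
        apply Rmult_le_compat_r; assumption. }
      assert (H12 : 0 <= B * t) by nra.
      assert (H13 : B * t <= (2 - 1 / 2 * t) * (B * t)) by nra.
      lra. }
  pose proof (half_pow_pos k); pose proof (half_pow_le_1 k).
  pose proof (Rabs_pos (a 0%nat)).
  eapply Rle_trans; [exact H|apply Rmult_le_compat; nra].
Qed.

(** By [perturbed_bounded] the increment at index [i] is at most [M * 2^-i] for the constant [M] set
    in the proof; a geometric series gives the factor 2. *)
Lemma perturbed_cauchy k j :
  Rabs (a (k + j) - a k) <=
  2 * (2 * K * (Rabs (a 0%nat) + 2 * B) + B) * (1 / 2) ^ k.
Proof.
  set (M := 2 * K * (Rabs (a 0%nat) + 2 * B) + B).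
  assert (HM : 0 <= M).
  { unfold M. pose proof (Rabs_pos (a 0%nat)). nra. }
  assert (H : Rabs (a (k + j)%nat - a k) <= 2 * M * (1 / 2) ^ k * (1 - (1 / 2) ^ j)).
  { induction j as [|j IH].
    - rewrite Nat.add_0_r. unfold Rminus at 1. rewrite Rplus_opp_r, Rabs_R0. simpl; lra.
    - replace (k + S j)%nat with (S (k + j)) by lia.
      replace (a (S (k + j)) - a k)
        with ((a (k + j)%nat - a k) + (al (k + j)%nat * a (k + j)%nat + be (k + j)%nat))
        by (rewrite Ha; ring).
      eapply Rle_trans; [apply Rabs_triang|].
      assert (H1 : Rabs (al (k + j)%nat * a (k + j)%nat + be (k + j)%nat)
                   <= M * (1 / 2) ^ (k + j)).
      { eapply Rle_trans; [apply Rabs_triang|]. rewrite Rabs_mult. unfold M.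
        pose proof (Hal (k + j)); pose proof (Hbe (k + j)).
        pose proof (perturbed_bounded (k + j)).
        pose proof (Rabs_pos (al (k + j)%nat)); pose proof (Rabs_pos (a (k + j)%nat)).
        pose proof (half_pow_pos (k + j)).
        set (t := (1 / 2) ^ (k + j)) in *.
        assert (Rabs (al (k + j)%nat) * Rabs (a (k + j)%nat)
                <= (K * t) * (2 * (Rabs (a 0%nat) + 2 * B)))
          by (apply Rmult_le_compat; assumption).
        nra. }
      rewrite pow_add in H1. simpl. nra. }
  pose proof (half_pow_pos k); pose proof (half_pow_pos j).
  assert (0 <= M * (1 / 2) ^ k) by nra. fold M. nra.
Qed.

End Perturbed.

(** * Normalized tails of shadowed orbits *)

Fixpoint prod (w : nat -> R) (k : nat) : R :=
  match k with O => 1 | S k => prod w k * w k end.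

Lemma prod_ge w (q : R) k : 1 <= q -> (forall i, q <= w i) -> q ^ k <= prod w k.
Proof.
  intros Hq Hw; induction k as [|k IH]; simpl; [lra|].
  assert (1 <= q ^ k) by (apply pow_R1_Rle; lra). pose proof (Hw k). nra.
Qed.

(* [x, y] is an orbit of [f_c] near the positive real axis, far from [0], with
   [y = b q]; it is shadowed by the orbit [u, v] of [f_0]. *)
Record shadowed (a b : R) (x y u v q : nat -> R) : Prop := {
  shx : forall k, 500 * 2 ^ k <= x k;
  shx_rec : forall k, x (S k) = 25 * x k ^ 2 - y k ^ 2 + a;
  shy : forall k, y k = b * q k;
  shyx : forall k, Rabs (y k) <= x k / 10;
  shq_rec : forall k, q (S k) = 10 * x k * q k + 1;
  shu_rec : forall k, u (S k) = 25 * u k ^ 2 - v k ^ 2;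
  shv_rec : forall k, v (S k) = 10 * u k * v k;
  shxu : forall k, Rabs (x k - u k) <= 1;
  shyv : forall k, Rabs (y k - v k) <= 1 }.

Section Tail.
Variables (a b : R) (x y u v q : nat -> R).
Hypothesis H : shadowed a b x y u v q.

Let U := prod (fun i => 10 * u i).

Lemma two_pow_ge_1 k : 1 <= 2 ^ k.
Proof. apply pow_R1_Rle; lra. Qed.

Lemma half_pow_eq k : (1 / 2) ^ k = / 2 ^ k.
Proof. unfold Rdiv; rewrite Rmult_1_l; apply pow_inv. Qed.

Lemma sh_u_ge k : 400 * 2 ^ k <= u k.
Proof.
  pose proof (shx _ _ _ _ _ _ _ H k); pose proof (shxu _ _ _ _ _ _ _ H k) as H1.
  apply Rabs_le_between in H1. pose proof (two_pow_ge_1 k). lra.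
Qed.

Lemma sh_v_le k : Rabs (v k) <= u k.
Proof.
  pose proof (shx _ _ _ _ _ _ _ H k); pose proof (shxu _ _ _ _ _ _ _ H k) as H1.
  pose proof (shyv _ _ _ _ _ _ _ H k) as H2; pose proof (shyx _ _ _ _ _ _ _ H k) as H3.
  apply Rabs_le_between in H1, H2, H3. pose proof (two_pow_ge_1 k).
  apply Rabs_le_between; lra.
Qed.

Lemma sh_U_ge k : 2 ^ k <= U k.
Proof.
  apply prod_ge; [lra|]. intros i. pose proof (sh_u_ge i); pose proof (two_pow_ge_1 i). lra.
Qed.

Lemma sh_inv_small k d w : Rabs d <= 1 -> 400 * 2 ^ k <= w ->
  Rabs (d / w) <= 1 / 400 * (1 / 2) ^ k.
Proof.
  intros Hd Hw. pose proof (two_pow_ge_1 k).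
  unfold Rdiv at 1. rewrite Rabs_mult, Rabs_inv, (Rabs_pos_eq w) by lra.
  replace (1 / 400 * (1 / 2) ^ k) with (1 * / (400 * 2 ^ k))
    by (rewrite half_pow_eq; field; lra).
  pose proof (Rabs_pos d).
  apply Rmult_le_compat; [lra| |lra|].
  - left; apply Rinv_0_lt_compat; lra.
  - apply Rinv_le_contravar; lra.
Qed.

(** Division by [U] brings the expanding recursion of [q] into the form treated in [Perturbed]:
    [x k] and [u k] are within 1 of each other and [u k >= 400 * 2 ^ k]. *)
Lemma sh_Q_rec k : q (S k) / U (S k)
  = (1 + (x k - u k) / u k) * (q k / U k) + 1 / U (S k).
Proof.
  pose proof (sh_u_ge k); pose proof (sh_U_ge k); pose proof (two_pow_ge_1 k).
  rewrite (shq_rec _ _ _ _ _ _ _ H k). unfold U; cbn [prod]; fold U. field. lra.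
Qed.

Lemma sh_U_S_ge k : 400 * 2 ^ k <= U (S k).
Proof.
  unfold U; cbn [prod]; fold U.
  pose proof (sh_u_ge k); pose proof (sh_U_ge k); pose proof (two_pow_ge_1 k). nra.
Qed.

Lemma sh_Q_bounded k : Rabs (q k / U k) <= 2 * (Rabs (q 0%nat) + 1).
Proof.
  pose proof (perturbed_bounded (fun k => q k / U k) (fun k => (x k - u k) / u k)
    (fun k => 1 / U (S k)) (1 / 400) (1 / 400)) as H1.
  cbv beta in H1. eapply Rle_trans; [apply H1|].
  - apply sh_Q_rec.
  - lra.
  - lra.
  - intros i; apply sh_inv_small; [apply (shxu _ _ _ _ _ _ _ H)|apply sh_u_ge].
  - intros i; apply sh_inv_small; [rewrite Rabs_R1; lra|apply sh_U_S_ge].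
  - unfold U; cbn [prod]. unfold Rdiv. rewrite Rinv_1, Rmult_1_r. lra.
Qed.

Lemma sh_Q_cauchy k j : Rabs (q (k + j)%nat / U (k + j) - q k / U k)
  <= (Rabs (q 0%nat) + 1) / 100 * (1 / 2) ^ k.
Proof.
  pose proof (perturbed_cauchy (fun k => q k / U k) (fun k => (x k - u k) / u k)
    (fun k => 1 / U (S k)) (1 / 400) (1 / 400)) as H1.
  cbv beta in H1. eapply Rle_trans; [apply H1|].
  - apply sh_Q_rec.
  - lra.
  - lra.
  - intros i; apply sh_inv_small; [apply (shxu _ _ _ _ _ _ _ H)|apply sh_u_ge].
  - intros i; apply sh_inv_small; [rewrite Rabs_R1; lra|apply sh_U_S_ge].
  - unfold U; cbn [prod]. unfold Rdiv. rewrite Rinv_1, Rmult_1_r.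
    apply Rmult_le_compat_r; [apply Rlt_le, half_pow_pos|].
    pose proof (Rabs_pos (q 0%nat)). lra.
Qed.

Lemma sh_v_prod k : v k = v 0%nat * U k.
Proof.
  induction k as [|k IH]; [unfold U; simpl; ring|].
  rewrite (shv_rec _ _ _ _ _ _ _ H), IH. unfold U; cbn [prod]. ring.
Qed.

(** [v m = v 0 * U m] and [y m = b * q m] stay within 1 of each other while [U m] tends to infinity,
    so [v 0] is [b] times the limit of [q m / U m]. The right-hand side is the Cauchy estimate for
    that limit. *)
Lemma sh_v_limit k : Rabs (v 0%nat - b * (q k / U k))
  <= Rabs b * ((Rabs (q 0%nat) + 1) / 100 * (1 / 2) ^ k).
Proof.
  apply Rle_of_half_pow with 1. intros j.
  replace (v 0%nat - b * (q k / U k))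
    with ((v 0%nat - b * (q (k + j)%nat / U (k + j)))
          + b * (q (k + j)%nat / U (k + j) - q k / U k)) by ring.
  eapply Rle_trans; [apply Rabs_triang|]. rewrite Rabs_mult, Rplus_comm.
  apply Rplus_le_compat.
  - apply Rmult_le_compat_l; [apply Rabs_pos|apply sh_Q_cauchy].
  - pose proof (sh_U_ge (k + j)) as H1; pose proof (two_pow_ge_1 (k + j)) as H2.
    replace (v 0%nat - b * (q (k + j)%nat / U (k + j)%nat))
      with (- (y (k + j)%nat - v (k + j)%nat) / U (k + j)%nat).
    2: { rewrite (shy _ _ _ _ _ _ _ H), sh_v_prod. field. lra. }
    unfold Rdiv. rewrite Rabs_mult, Rabs_inv, Rabs_Ropp, (Rabs_pos_eq (U _)) by lra.
    apply Rmult_le_compat.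
    + apply Rabs_pos.
    + left; apply Rinv_0_lt_compat; lra.
    + apply (shyv _ _ _ _ _ _ _ H).
    + replace (1 * / 2) with (1 / 2) by field.
      rewrite (Nat.add_comm k j) in *.
      eapply Rle_trans; [|apply (half_pow_add k j)].
      rewrite half_pow_eq. apply Rinv_le_contravar; lra.
Qed.

Lemma sh_v_bound : Rabs (v 0%nat) <= Rabs b * (2 * (Rabs (q 0%nat) + 1)).
Proof.
  pose proof (sh_v_limit 0) as H1. unfold U in H1; cbn [prod pow] in H1.
  rewrite Rdiv_1_r in H1.
  replace (v 0%nat) with ((v 0%nat - b * q 0%nat) + b * q 0%nat) by ring.
  eapply Rle_trans; [apply Rabs_triang|]. rewrite Rabs_mult.
  pose proof (Rmult_le_pos _ _ (Rabs_pos b) (Rabs_pos (q 0%nat))).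
  pose proof (Rabs_pos b). lra.
Qed.

End Tail.

(** * Comparison with the orbit of a real parameter *)

Section Compare.
Variables (a a0 b : R) (x y u v q x0 y0 u0 v0 q0 xi eta : nat -> R).
Hypothesis H : shadowed a b x y u v q.
Hypothesis H0 : shadowed a0 0 x0 y0 u0 v0 q0.
Hypothesis Hxi : forall k, xi (S k) = 25 * (x k + x0 k) * xi k + 1.
Hypothesis Heta : forall k, eta (S k) = 25 * (x k + x0 k) * eta k - q k ^ 2.
Hypothesis Hx : forall k, x k - x0 k = (a - a0) * xi k + b ^ 2 * eta k.

Let U := prod (fun i => 10 * u i).
Let W := prod (fun i => 25 * (u i + u0 i)).

(** The bound on [v0 0] is proportional to the imaginary part of the parameter, here 0, and every
    [v0 k] is a multiple of [v0 0]. *)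
Lemma real_v_0 k : v0 k = 0.
Proof.
  rewrite (sh_v_prod _ _ _ _ _ _ _ H0).
  pose proof (sh_v_bound _ _ _ _ _ _ _ H0) as H1.
  rewrite Rabs_R0, Rmult_0_l in H1. pose proof (Rabs_pos (v0 0%nat)).
  destruct (Req_dec (v0 0%nat) 0) as [E|E]; [rewrite E; ring|].
  apply Rabs_pos_lt in E; lra.
Qed.

Lemma sh_W_ge k : 2 ^ k <= W k.
Proof.
  apply prod_ge; [lra|]. intros i.
  pose proof (sh_u_ge _ _ _ _ _ _ _ H i); pose proof (sh_u_ge _ _ _ _ _ _ _ H0 i).
  pose proof (two_pow_ge_1 i). lra.
Qed.

Lemma sh_W_S_ge k : 400 * 2 ^ k <= W (S k).
Proof.
  unfold W; cbn [prod]; fold W.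
  pose proof (sh_u_ge _ _ _ _ _ _ _ H k); pose proof (sh_u_ge _ _ _ _ _ _ _ H0 k).
  pose proof (sh_W_ge k); pose proof (two_pow_ge_1 k). nra.
Qed.

(** From index [k] to [k + 1] the left side gains the factor [200 u k ^ 2], while the right side
    gains at least [25 u (k + 1) >= 600 u k ^ 2]. Hence squares of quantities of order [U], such as
    [v] and [q], are summable after division by [W]. *)
Lemma sh_U_sqr_le k : U k ^ 2 * 2 ^ k <= W (S k).
Proof.
  induction k as [|k IH].
  - unfold U, W; cbn [prod pow].
    pose proof (sh_u_ge _ _ _ _ _ _ _ H 0); pose proof (sh_u_ge _ _ _ _ _ _ _ H0 0).
    cbn [pow] in *. lra.
  - change (W (S (S k))) with (W (S k) * (25 * (u (S k) + u0 (S k)))).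
    change (U (S k)) with (U k * (10 * u k)). change (2 ^ S k) with (2 * 2 ^ k).
    pose proof (sh_u_ge _ _ _ _ _ _ _ H k); pose proof (sh_u_ge _ _ _ _ _ _ _ H0 (S k)).
    pose proof (two_pow_ge_1 k); pose proof (two_pow_ge_1 (S k)).
    pose proof (sh_v_le _ _ _ _ _ _ _ H k) as H5. apply Rabs_le_between in H5.
    assert (H6 : 24 * u k ^ 2 <= u (S k)) by (rewrite (shu_rec _ _ _ _ _ _ _ H); nra).
    apply Rle_trans with (W (S k) * (200 * u k ^ 2)).
    + replace ((U k * (10 * u k)) ^ 2 * (2 * 2 ^ k))
        with (U k ^ 2 * 2 ^ k * (200 * u k ^ 2)) by ring.
      apply Rmult_le_compat_r; [nra|exact IH].
    + apply Rmult_le_compat_l; [pose proof (sh_W_S_ge k); lra|nra].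
Qed.

Lemma sh_sqr_W_small k d M : Rabs d <= M * U k -> 0 <= M ->
  Rabs (d ^ 2 / W (S k)) <= M ^ 2 * (1 / 2) ^ k.
Proof.
  intros Hd HM. pose proof (sh_W_S_ge k); pose proof (two_pow_ge_1 k).
  pose proof (sh_U_sqr_le k) as H3.
  unfold Rdiv at 1. rewrite Rabs_pos_eq.
  2: { apply Rmult_le_pos; [apply pow2_ge_0|left; apply Rinv_0_lt_compat; lra]. }
  apply Rmult_le_reg_r with (W (S k)); [lra|].
  rewrite Rmult_assoc, Rinv_l, Rmult_1_r by lra.
  apply Rle_trans with ((M * U k) ^ 2).
  - rewrite <- (pow2_abs d). apply pow_incr. split; [apply Rabs_pos|exact Hd].
  - replace ((M * U k) ^ 2) with (M ^ 2 * (1 / 2) ^ k * (U k ^ 2 * 2 ^ k)).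
    2: { rewrite half_pow_eq. field. lra. }
    apply Rmult_le_compat_l; [|exact H3].
    apply Rmult_le_pos; [apply pow2_ge_0|apply Rlt_le, half_pow_pos].
Qed.

Let Mq := 2 * (Rabs (q 0%nat) + 1).

Lemma Mq_pos : 0 <= Mq.
Proof. unfold Mq; pose proof (Rabs_pos (q 0%nat)); lra. Qed.

Lemma xi_rec k : xi (S k) / W (S k)
  = (1 + ((x k - u k) + (x0 k - u0 k)) / (u k + u0 k)) * (xi k / W k) + 1 / W (S k).
Proof.
  pose proof (sh_u_ge _ _ _ _ _ _ _ H k); pose proof (sh_u_ge _ _ _ _ _ _ _ H0 k).
  pose proof (sh_W_ge k); pose proof (two_pow_ge_1 k).
  rewrite Hxi. unfold W; cbn [prod]; fold W. field. lra.
Qed.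

Lemma eta_rec k : eta (S k) / W (S k)
  = (1 + ((x k - u k) + (x0 k - u0 k)) / (u k + u0 k)) * (eta k / W k)
    + - (q k ^ 2 / W (S k)).
Proof.
  pose proof (sh_u_ge _ _ _ _ _ _ _ H k); pose proof (sh_u_ge _ _ _ _ _ _ _ H0 k).
  pose proof (sh_W_ge k); pose proof (two_pow_ge_1 k).
  rewrite Heta. unfold W; cbn [prod]; fold W. field. lra.
Qed.

Lemma err_small k : Rabs (((x k - u k) + (x0 k - u0 k)) / (u k + u0 k))
  <= 1 / 400 * (1 / 2) ^ k.
Proof.
  pose proof (sh_u_ge _ _ _ _ _ _ _ H k); pose proof (sh_u_ge _ _ _ _ _ _ _ H0 k).
  pose proof (two_pow_ge_1 k).
  replace (((x k - u k) + (x0 k - u0 k)) / (u k + u0 k))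
    with (((x k - u k) + (x0 k - u0 k)) / 2 / ((u k + u0 k) / 2)) by (field; lra).
  apply sh_inv_small; [|lra].
  pose proof (shxu _ _ _ _ _ _ _ H k) as H4; pose proof (shxu _ _ _ _ _ _ _ H0 k) as H5.
  apply Rabs_le_between in H4, H5. apply Rabs_le_between; lra.
Qed.

Lemma xi_cauchy k j : Rabs (xi (k + j)%nat / W (k + j) - xi k / W k)
  <= (Rabs (xi 0%nat) + 1) / 100 * (1 / 2) ^ k.
Proof.
  pose proof (perturbed_cauchy (fun k => xi k / W k)
    (fun k => ((x k - u k) + (x0 k - u0 k)) / (u k + u0 k))
    (fun k => 1 / W (S k)) (1 / 400) (1 / 400)) as H1.
  cbv beta in H1. eapply Rle_trans; [apply H1|].
  - apply xi_rec.
  - lra.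
  - lra.
  - apply err_small.
  - intros i; apply sh_inv_small; [rewrite Rabs_R1; lra|apply sh_W_S_ge].
  - change (W 0%nat) with 1. rewrite Rdiv_1_r.
    apply Rmult_le_compat_r; [apply Rlt_le, half_pow_pos|].
    pose proof (Rabs_pos (xi 0%nat)). lra.
Qed.

Lemma eta_bounded k : Rabs (eta k / W k) <= 2 * (Rabs (eta 0%nat) + 2 * Mq ^ 2).
Proof.
  pose proof (perturbed_bounded (fun k => eta k / W k)
    (fun k => ((x k - u k) + (x0 k - u0 k)) / (u k + u0 k))
    (fun k => - (q k ^ 2 / W (S k))) (1 / 400) (Mq ^ 2)) as H1.
  cbv beta in H1. eapply Rle_trans; [apply H1|].
  - apply eta_rec.
  - lra.
  - apply pow2_ge_0.
  - apply err_small.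
  - intros i. rewrite Rabs_Ropp. apply sh_sqr_W_small; [|apply Mq_pos].
    pose proof (sh_Q_bounded _ _ _ _ _ _ _ H i) as H3. fold U in H3. fold Mq in H3.
    pose proof (sh_U_ge _ _ _ _ _ _ _ H i) as H4. fold U in H4.
    pose proof (two_pow_ge_1 i).
    replace (q i) with (q i / U i * U i) by (field; lra).
    rewrite Rabs_mult, (Rabs_pos_eq (U i)) by lra.
    apply Rmult_le_compat_r; lra.
  - change (W 0%nat) with 1. rewrite Rdiv_1_r. lra.
Qed.

(** As [v0] vanishes, [u - u0] satisfies [d (k + 1) = 25 (u k + u0 k) d k - v k ^ 2]; so [d k / W k]
    changes only by [v k ^ 2 / W (k + 1)], and [v k] is at most [|b| Mq U k]. *)
Lemma sh_du_telescope k : Rabs (u 0%nat - u0 0%nat - (u k - u0 k) / W k)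
  <= 2 * (Rabs b * Mq) ^ 2 * (1 - (1 / 2) ^ k).
Proof.
  induction k as [|k IH].
  - change (W 0%nat) with 1. rewrite Rdiv_1_r. unfold Rminus at 1.
    rewrite Rplus_opp_r, Rabs_R0. cbn [pow]; lra.
  - replace (u 0%nat - u0 0%nat - (u (S k) - u0 (S k)) / W (S k))
      with ((u 0%nat - u0 0%nat - (u k - u0 k) / W k) + v k ^ 2 / W (S k)).
    2: { rewrite (shu_rec _ _ _ _ _ _ _ H), (shu_rec _ _ _ _ _ _ _ H0), (real_v_0 k).
         change (W (S k)) with (W k * (25 * (u k + u0 k))).
         pose proof (sh_u_ge _ _ _ _ _ _ _ H k); pose proof (sh_u_ge _ _ _ _ _ _ _ H0 k).
         pose proof (sh_W_ge k); pose proof (two_pow_ge_1 k). field. lra. }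
    eapply Rle_trans; [apply Rabs_triang|].
    assert (H1 : Rabs (v k ^ 2 / W (S k)) <= (Rabs b * Mq) ^ 2 * (1 / 2) ^ k).
    { apply sh_sqr_W_small.
      - rewrite (sh_v_prod _ _ _ _ _ _ _ H). fold U.
        pose proof (sh_U_ge _ _ _ _ _ _ _ H k) as H4. fold U in H4.
        pose proof (two_pow_ge_1 k).
        rewrite Rabs_mult, (Rabs_pos_eq (U k)) by lra.
        apply Rmult_le_compat_r; [lra|]. apply (sh_v_bound _ _ _ _ _ _ _ H).
      - apply Rmult_le_pos; [apply Rabs_pos|apply Mq_pos]. }
    cbn [pow]. cbn [pow] in IH, H1. lra.
Qed.

(** Coefficient of the error of second order in [b]: the first summand collects the squares of [v]
    from the telescoping sum, the second bounds [eta / W]. *)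
Definition b2_const (Q E : R) : R := 2 * Q ^ 2 + 2 * (E + 2 * Q ^ 2).

(** At a late index [m] the telescoped difference is [(u m - u0 m) / W m]. Shadowing replaces it by
    [(x m - x0 m) / W m] with error at most [2 / W m], and the exact formula [Hx] splits this into a
    [xi] and an [eta] term. Then [m] tends to infinity. *)
Lemma sh_u_limit k :
  Rabs (u 0%nat - u0 0%nat - (a - a0) * (xi k / W k))
  <= Rabs (a - a0) * ((Rabs (xi 0%nat) + 1) / 100 * (1 / 2) ^ k)
     + b ^ 2 * b2_const Mq (Rabs (eta 0%nat)).
Proof.
  apply Rle_of_half_pow with 2. intros j.
  set (m := (k + j)%nat).
  pose proof (sh_W_ge m) as H1; pose proof (two_pow_ge_1 m) as H2.
  replace (u 0%nat - u0 0%nat - (a - a0) * (xi k / W k)) with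
    ((a - a0) * (xi m / W m - xi k / W k)
     + ((u 0%nat - u0 0%nat - (u m - u0 m) / W m) + (b ^ 2 * (eta m / W m)
     + ((u m - x m) + (x0 m - u0 m)) / W m))).
  2: { replace (x m) with (x0 m + ((a - a0) * xi m + b ^ 2 * eta m))
         by (rewrite <- Hx; ring). field. split; try lra.
       pose proof (sh_W_ge k); pose proof (two_pow_ge_1 k); lra. }
  eapply Rle_trans; [apply Rabs_triang|]. rewrite Rabs_mult.
  rewrite Rplus_assoc. apply Rplus_le_compat.
  { apply Rmult_le_compat_l; [apply Rabs_pos|apply xi_cauchy]. }
  eapply Rle_trans; [apply Rabs_triang|].
  unfold b2_const. rewrite Rmult_plus_distr_l, Rplus_assoc.
  apply Rplus_le_compat.
  { eapply Rle_trans; [apply sh_du_telescope|].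
    pose proof (half_pow_pos m). rewrite Rpow_mult_distr, pow2_abs.
    pose proof (pow2_ge_0 Mq); pose proof (pow2_ge_0 b).
    pose proof (Rmult_le_pos _ _ H4 H5). nra. }
  eapply Rle_trans; [apply Rabs_triang|]. rewrite Rabs_mult, (Rabs_pos_eq (b ^ 2))
    by apply pow2_ge_0.
  apply Rplus_le_compat.
  { apply Rmult_le_compat_l; [apply pow2_ge_0|apply eta_bounded]. }
  unfold Rdiv at 1. rewrite Rabs_mult, Rabs_inv, (Rabs_pos_eq (W m)) by lra.
  apply Rmult_le_compat.
  - apply Rabs_pos.
  - left; apply Rinv_0_lt_compat; lra.
  - pose proof (shxu _ _ _ _ _ _ _ H m) as H4; pose proof (shxu _ _ _ _ _ _ _ H0 m) as H5.
    apply Rabs_le_between in H4, H5. apply Rabs_le_between; lra.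
  - unfold m in *. rewrite (Nat.add_comm k j) in *.
    eapply Rle_trans; [|apply (half_pow_add k j)].
    rewrite half_pow_eq. apply Rinv_le_contravar; lra.
Qed.

End Compare.

(** * Differentiability at real parameters *)

Lemma continuous_locally_lt (g : C -> R) (c0 : C) : continuous g c0 ->
  forall eps, 0 < eps -> locally c0 (fun c => Rabs (g c - g c0) < eps).
Proof.
  intros Hg eps He.
  exact (proj1 (filterlim_locally g (g c0)) Hg (mkposreal eps He)).
Qed.

Lemma continuous_squeeze (g r : C -> R) (c0 : C) : continuous r c0 -> r c0 = 0 ->
  locally c0 (fun c => Rabs (g c - g c0) <= r c) -> continuous g c0.
Proof.
  intros Hr Hr0 Hg. apply filterlim_locally. intros [eps He].
  generalize (filter_and _ _ Hg (continuous_locally_lt r c0 Hr eps He)).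
  apply filter_imp. intros c [H1 H2]. rewrite Hr0 in H2.
  change (Rabs (g c - g c0) < eps). apply Rabs_def2 in H2. lra.
Qed.

Ltac cont :=
  first
    [ assumption
    | apply continuous_const
    | lazymatch goal with
      | |- continuous (fun _ => _ + _) _ => apply (continuous_plus (V := R_NormedModule)); cont
      | |- continuous (fun _ => _ - _) _ => apply (continuous_minus (V := R_NormedModule)); cont
      | |- continuous (fun _ => _ * _) _ => apply (continuous_mult (K := R_AbsRing)); cont
      | |- continuous (fun _ => Rabs _) _ =>
          apply (continuous_comp _ Rabs); [cont|apply continuous_Rabs]
      | _ => idtac
      end ].

Lemma continuous_Re (c0 : C) : continuous Re c0.
Proof. apply continuous_fst. Qed.

Lemma continuous_Im (c0 : C) : continuous Im c0.
Proof. apply continuous_snd. Qed.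

Lemma continuous_orbit_Re_Im j c0 :
  continuous (fun c => Re (orbit c j)) c0 /\ continuous (fun c => Im (orbit c j)) c0.
Proof.
  induction j as [|j [IH1 IH2]].
  - split; [apply continuous_Re|apply continuous_Im].
  - pose proof (continuous_Re c0); pose proof (continuous_Im c0). split.
    + apply (continuous_ext (fun c => 25 * (Re (orbit c j) * (Re (orbit c j) * 1))
        - Im (orbit c j) * (Im (orbit c j) * 1) + Re c)).
      { intros c. symmetry; exact (f_Re c (orbit c j)). }
      cont.
    + apply (continuous_ext (fun c => 10 * Re (orbit c j) * Im (orbit c j) + Im c)).
      { intros c. symmetry; exact (f_Im c (orbit c j)). }
      cont.
Qed.

(* [Im (orbit c j) = Im c * qs c j], and for real [c0] the real parts of the
   orbits of [c] and [c0] differ by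
   [(Re c - Re c0) * xis c0 c j + Im c ^ 2 * etas c0 c j]. *)
Fixpoint qs (c : C) (j : nat) : R :=
  match j with O => 1 | S j => 10 * Re (orbit c j) * qs c j + 1 end.

Fixpoint xis (c0 c : C) (j : nat) : R :=
  match j with
  | O => 1
  | S j => 25 * (Re (orbit c j) + Re (orbit c0 j)) * xis c0 c j + 1
  end.

Fixpoint etas (c0 c : C) (j : nat) : R :=
  match j with
  | O => 0
  | S j => 25 * (Re (orbit c j) + Re (orbit c0 j)) * etas c0 c j - qs c j ^ 2
  end.

Lemma continuous_qs j c0 : continuous (fun c => qs c j) c0.
Proof.
  induction j as [|j IH]; cbn [qs]; [apply continuous_const|].
  destruct (continuous_orbit_Re_Im j c0). cont.
Qed.

Lemma continuous_xis j c0 : continuous (fun c => xis c0 c j) c0.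
Proof.
  induction j as [|j IH]; cbn [xis]; [apply continuous_const|].
  destruct (continuous_orbit_Re_Im j c0). cont.
Qed.

Lemma continuous_etas j c0 : continuous (fun c => etas c0 c j) c0.
Proof.
  induction j as [|j IH]; cbn [etas pow]; [apply continuous_const|].
  destruct (continuous_orbit_Re_Im j c0). pose proof (continuous_qs j c0). cont.
Qed.

Lemma orbit_Re_S c j :
  Re (orbit c (S j)) = 25 * Re (orbit c j) ^ 2 - Im (orbit c j) ^ 2 + Re c.
Proof. exact (f_Re c (orbit c j)). Qed.

Lemma orbit_Im_S c j :
  Im (orbit c (S j)) = 10 * Re (orbit c j) * Im (orbit c j) + Im c.
Proof. exact (f_Im c (orbit c j)). Qed.

Lemma orbit_Im_qs c j : Im (orbit c j) = Im c * qs c j.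
Proof.
  induction j as [|j IH]; [cbn; ring|].
  rewrite orbit_Im_S, IH. cbn [qs]. ring.
Qed.

Lemma orbit_Re_diff c0 c j : Im c0 = 0 ->
  Re (orbit c j) - Re (orbit c0 j)
  = (Re c - Re c0) * xis c0 c j + Im c ^ 2 * etas c0 c j.
Proof.
  intros H0. induction j as [|j IH]; [cbn; ring|].
  rewrite !orbit_Re_S, !orbit_Im_qs, H0. cbn [xis etas].
  assert (E : Re (orbit c j) = Re (orbit c0 j)
     + ((Re c - Re c0) * xis c0 c j + Im c ^ 2 * etas c0 c j)) by (rewrite <- IH; ring).
  rewrite E. ring.
Qed.

(** Stronger than differentiability with a diagonal derivative: the error of the imaginary part is
    measured by [|Im c|] alone. This forces real values at real parameters near [c0], and it is
    stable under pullback by [f_0], where the imaginary part is just divided by [10 Re (g c)]. *)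
Definition real_diff (c0 : C) (g : C -> C) (A V : R) : Prop :=
  forall eps, 0 < eps ->
    locally c0 (fun c => Rabs (Im (g c) - Im c * V) <= eps * Rabs (Im c)) /\
    locally c0 (fun c => Rabs (Re (g c) - Re (g c0) - (Re c - Re c0) * A)
                         <= eps * (Rabs (Re c - Re c0) + Rabs (Im c))).

Lemma real_diff_has_real_derivative c0 g A V : Im c0 = 0 ->
  real_diff c0 g A V ->
  has_real_derivative g c0 (fun z => (A * Re z, V * Im z)).
Proof.
  intros H0 Hd. split.
  - split.
    + intros [x1 x2] [y1 y2]. apply C_eq; cbn; unfold plus; cbn; ring.
    + intros k [x1 x2]. apply C_eq; cbn; unfold scal; cbn; unfold mult; cbn; ring.
    + exists (Rabs A + Rabs V + 1).
      pose proof (Rabs_pos A); pose proof (Rabs_pos V). split; [lra|]. intros z.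
      change (@norm _ C_R_NormedModule z) with (@norm _ (prod_NormedModule R_AbsRing R_NormedModule R_NormedModule) z).
      rewrite <- !Cmod_norm.
      eapply Rle_trans; [apply Cmod_le_Re_Im|]. cbn [Re Im fst snd].
      rewrite !Rabs_mult. pose proof (re_le_Cmod z); pose proof (Im_le_Cmod z).
      pose proof (Rabs_pos (Re z)); pose proof (Rabs_pos (Im z)). nra.
  - intros c Hc. apply (is_filter_lim_locally_unique (V := C_R_NormedModule) c0 c) in Hc. subst c.
    intros [eps He]. cbn [pos].
    (* Three error terms arise, one from the imaginary part and two from the real part, each at most
       [eps / 3] times the norm. *)
    destruct (Hd (eps / 3)) as [H1 H2]; [lra|].
    generalize (filter_and _ _ H1 H2). apply filter_imp. intros c [H3 H4].
    rewrite <- !Cmod_norm.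
    assert (E0 : Im (g c0) = 0).
    { pose proof (locally_singleton _ _ H1) as H5. cbv beta in H5.
      rewrite H0, Rabs_R0, Rmult_0_l, Rmult_0_r, Rminus_0_r in H5.
      destruct (Req_dec (Im (g c0)) 0) as [E|E]; [exact E|].
      apply Rabs_pos_lt in E; lra. }
    eapply Rle_trans; [apply Cmod_le_Re_Im|].
    match goal with |- Rabs ?P + Rabs ?Q <= _ =>
      replace P with (Re (g c) - Re (g c0) - (Re c - Re c0) * A);
      [replace Q with (Im (g c) - Im c * V)|] end.
    + lazymatch goal with |- _ <= _ * ?N => set (d := N) end.
      assert (H5 : Rabs (Re c - Re c0) <= d) by exact (re_le_Cmod (minus c c0)).
      assert (H6 : Rabs (Im c) <= d).
      { pose proof (Im_le_Cmod (minus c c0)) as H6.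
        change (Im (minus c c0)) with (Im c - Im c0) in H6.
        rewrite H0, Rminus_0_r in H6. exact H6. }
      assert (H7 : 0 <= eps / 3) by lra.
      pose proof (Rmult_le_compat_l _ _ _ H7 H5); pose proof (Rmult_le_compat_l _ _ _ H7 H6).
      lra.
    + change (Im (g c) - Im c * V = Im (g c) - Im (g c0) - V * (Im c - Im c0)).
      rewrite E0, H0. ring.
    + change (Re (g c) - Re (g c0) - (Re c - Re c0) * A
        = Re (g c) - Re (g c0) - A * (Re c - Re c0)). ring.
Qed.

Lemma half_pow_small C eps : 0 < eps -> exists k, C * (1 / 2) ^ k < eps.
Proof.
  intros He. pose proof (Rabs_pos C).
  destruct (pow_lt_1_zero (1 / 2)) with (y := eps / (Rabs C + 1)) as [N HN].
  { rewrite Rabs_pos_eq; lra. }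
  { apply Rdiv_lt_0_compat; lra. }
  exists N. pose proof (HN N (le_n N)) as H1. pose proof (half_pow_pos N).
  rewrite Rabs_pos_eq in H1 by lra.
  apply (Rmult_lt_compat_l (Rabs C + 1)) in H1; [|lra].
  replace ((Rabs C + 1) * (eps / (Rabs C + 1))) with eps in H1 by (field; lra).
  pose proof (Rle_abs C). nra.
Qed.

Lemma geometric_limit (a : nat -> R) C :
  (forall k j, Rabs (a (k + j)%nat - a k) <= C * (1 / 2) ^ k) ->
  exists l, forall k, Rabs (l - a k) <= C * (1 / 2) ^ k.
Proof.
  intros Ha.
  assert (Hc : ex_lim_seq_cauchy a).
  { intros [eps He]. destruct (half_pow_small C (eps / 2)) as [N HN]; [lra|].
    exists N. intros i j Hi Hj. cbn [pos].
    pose proof (Ha N (i - N)%nat) as H1; pose proof (Ha N (j - N)%nat) as H2.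
    replace (N + (i - N))%nat with i in H1 by lia.
    replace (N + (j - N))%nat with j in H2 by lia.
    apply Rabs_le_between in H1, H2. apply Rabs_def1; lra. }
  apply ex_lim_seq_cauchy_corr in Hc. destruct Hc as [l Hl].
  exists l. intros k.
  assert (H1 : is_lim_seq (fun j => Rabs (a (k + j)%nat - a k)) (Rabs (l - a k))).
  { apply (is_lim_seq_abs (fun j => a (k + j)%nat - a k) (l - a k)).
    apply (is_lim_seq_minus' _ _ l (a k)); [|apply is_lim_seq_const].
    apply (is_lim_seq_ext (fun j => a (j + k)%nat)).
    - intros j. now rewrite Nat.add_comm.
    - now apply is_lim_seq_incr_n. }
  apply (is_lim_seq_le _ _ _ _ (Ha k) H1 (is_lim_seq_const (C * (1 / 2) ^ k))).
Qed.

Lemma Rabs_0_eq x : Rabs x <= 0 -> x = 0.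
Proof.
  intros H. destruct (Req_dec x 0) as [E|E]; [exact E|].
  apply Rabs_pos_lt in E; lra.
Qed.

Lemma real_diff_Im_0 c0 g A V : Im c0 = 0 -> real_diff c0 g A V -> Im (g c0) = 0.
Proof.
  intros H0 Hd. destruct (Hd 1 Rlt_0_1) as [H1 _]. apply locally_singleton in H1.
  cbv beta in H1. rewrite H0, Rabs_R0, Rmult_0_l, Rmult_0_r, Rminus_0_r in H1.
  now apply Rabs_0_eq.
Qed.

Lemma continuous_inv_at (g : C -> R) c0 : continuous g c0 -> g c0 <> 0 ->
  continuous (fun c => / g c) c0.
Proof.
  intros Hg H. apply (continuous_comp g Rinv); [exact Hg|].
  apply continuity_pt_filterlim, continuity_pt_inv; [apply continuity_pt_id|exact H].
Qed.

Lemma locally_close_to_0 (r : C -> R) c0 eps : continuous r c0 -> r c0 = 0 -> 0 < eps ->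
  locally c0 (fun c => Rabs (r c) < eps).
Proof.
  intros Hr Hr0 He. generalize (continuous_locally_lt r c0 Hr eps He).
  apply filter_imp. intros c H. rewrite Hr0, Rminus_0_r in H. exact H.
Qed.

(** * Pulling a derivative back through one step of [f_0] *)

Section Pullback.
Variables (c0 : C) (g g1 : C -> C) (s A V : R).
Hypothesis Hc0 : Im c0 = 0.
Hypothesis Hs : s = 1 \/ s = -1.
Hypothesis Hg : locally c0 (fun c => g1 c = f 5 0 (RtoC 0) (g c) /\ 1 / 25 <= s * Re (g c)).
Hypothesis Hd : real_diff c0 g1 A V.

Let u0 := Re (g c0).

Lemma pullback_at_c0 : 1 / 25 <= s * u0 /\ Re (g1 c0) = 25 * u0 ^ 2.
Proof.
  destruct (locally_singleton _ _ Hg) as [E H]. split; [exact H|].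
  pose proof (real_diff_Im_0 _ _ _ _ Hc0 Hd) as H1.
  rewrite E, f_Im in H1. rewrite E, f_Re. change (Re (RtoC 0)) with 0.
  change (Im (RtoC 0)) with 0 in H1. fold u0 in H1 |- *.
  assert (u0 <> 0) by (intros E0; fold u0 in H; rewrite E0 in H; lra).
  assert (H2 : Im (g c0) = 0) by nra. rewrite H2. ring.
Qed.

Lemma pullback_Im c : g1 c = f 5 0 (RtoC 0) (g c) -> Im (g1 c) = 10 * Re (g c) * Im (g c).
Proof. intros ->; rewrite f_Im; cbn; ring. Qed.

Lemma pullback_Re c : g1 c = f 5 0 (RtoC 0) (g c) ->
  Re (g1 c) = 25 * Re (g c) ^ 2 - Im (g c) ^ 2.
Proof. intros ->; rewrite f_Re; cbn; ring. Qed.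

Lemma Rabs_div_s x w d : 0 < d -> d <= s * w -> Rabs (x / w) <= Rabs x / d.
Proof.
  intros Hd0 Hw. assert (H : d <= Rabs w).
  { destruct Hs as [->| ->]; [rewrite Rmult_1_l in Hw|];
      unfold Rabs; destruct (Rcase_abs w); lra. }
  unfold Rdiv. rewrite Rabs_mult, Rabs_inv.
  apply Rmult_le_compat_l; [apply Rabs_pos|]. apply Rinv_le_contravar; assumption.
Qed.

(** The factor [5/2] is the inverse of [10 * (1/25)]. As [Re (g c)] and [u0] have the common sign
    [s], the divisor [25 (Re (g c) + u0)] has modulus at least 2. *)
Lemma pullback_bounds : locally c0 (fun c =>
  Rabs (Im (g c)) <= 5 / 2 * (Rabs V + 1) * Rabs (Im c) /\
  Rabs (Re (g c) - u0) <=
    (Rabs A + 1) * (Rabs (Re c - Re c0) + Rabs (Im c))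
    + (5 / 2 * (Rabs V + 1) * Rabs (Im c)) ^ 2).
Proof.
  destruct pullback_at_c0 as [Hu0 E0]. destruct (Hd 1 Rlt_0_1) as [H1 H2].
  generalize (filter_and _ _ Hg (filter_and _ _ H1 H2)). apply filter_imp.
  intros c [[E Hu] [H3 H4]].
  assert (H5 : Rabs (Im (g c)) <= 5 / 2 * (Rabs V + 1) * Rabs (Im c)).
  { assert (Hn : Re (g c) <> 0) by (intros E1; rewrite E1 in Hu; lra).
    replace (Im (g c)) with (Im (g1 c) / (10 * Re (g c)))
      by (rewrite (pullback_Im c E); field; exact Hn).
    eapply Rle_trans; [apply (Rabs_div_s _ _ (2 / 5)); lra|].
    replace (Im (g1 c)) with ((Im (g1 c) - Im c * V) + Im c * V) by ring.
    pose proof (Rabs_triang (Im (g1 c) - Im c * V) (Im c * V)) as H6.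
    rewrite Rabs_mult in H6. lra. }
  split; [exact H5|].
  assert (Hn : Re (g c) + u0 <> 0).
  { intros E1. assert (s * (Re (g c) + u0) = 0) by (rewrite E1; ring). lra. }
  replace (Re (g c) - u0) with
    ((Re (g1 c) - Re (g1 c0) + Im (g c) ^ 2) / (25 * (Re (g c) + u0)))
    by (rewrite (pullback_Re c E), E0; field; exact Hn).
  eapply Rle_trans; [apply (Rabs_div_s _ _ 1); lra|]. rewrite Rdiv_1_r.
  eapply Rle_trans; [apply Rabs_triang|]. apply Rplus_le_compat.
  - replace (Re (g1 c) - Re (g1 c0)) with
      ((Re (g1 c) - Re (g1 c0) - (Re c - Re c0) * A) + (Re c - Re c0) * A) by ring.
    eapply Rle_trans; [apply Rabs_triang|]. rewrite Rabs_mult.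
    pose proof (Rmult_le_pos _ _ (Rabs_pos A) (Rabs_pos (Im c))). lra.
  - rewrite <- RPow_abs. apply pow_incr. split; [apply Rabs_pos|exact H5].
Qed.

Lemma pullback_continuous : continuous (fun c => Re (g c)) c0.
Proof.
  pose proof (continuous_Re c0); pose proof (continuous_Im c0).
  apply (continuous_squeeze (fun c => Re (g c)) (fun c =>
    (Rabs A + 1) * (Rabs (Re c - Re c0) + Rabs (Im c))
    + (5 / 2 * (Rabs V + 1) * Rabs (Im c)) ^ 2)).
  - cbn [pow]. cont.
  - rewrite Hc0, Rabs_R0. unfold Rminus. rewrite Rplus_opp_r, Rabs_R0. ring.
  - generalize pullback_bounds. apply filter_imp. intros c [_ H1]. exact H1.
Qed.

(** [Im (g c)] is [Im (g1 c) / (10 Re (g c))], and [25 (Re (g c) + u0) (Re (g c) - u0)] is the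
    increment of [Re g1] plus [Im (g c) ^ 2]. That square is of order [|Im c| ^ 2], and the divisors
    converge to [10 u0] and [50 u0]. *)
Lemma real_diff_pullback : real_diff c0 g (A / (50 * u0)) (V / (10 * u0)).
Proof.
  destruct pullback_at_c0 as [Hu0 E0].
  assert (Hn0 : u0 <> 0) by (intros E1; rewrite E1 in Hu0; lra).
  assert (Hn1 : 10 * u0 <> 0) by lra. assert (Hn2 : 25 * (u0 + u0) <> 0) by lra.
  pose proof pullback_continuous as Hcont.
  pose proof (Rabs_pos A) as HA; pose proof (Rabs_pos V) as HV.
  intros eps He. destruct (Hd (eps / 5)) as [H1 H2]; [lra|].
  split.
  - assert (Hr : continuous (fun c => V * (/ (10 * Re (g c)) - / (10 * u0))) c0).
    { cont. apply (continuous_inv_at (fun c => 10 * Re (g c))); [cont|exact Hn1]. }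
    pose proof (locally_close_to_0 _ c0 (eps / 2) Hr ltac:(cbv beta; fold u0; ring) ltac:(lra)) as Hr'.
    generalize (filter_and _ _ Hg (filter_and _ _ H1 Hr')). apply filter_imp.
    intros c [[E Hu] [H3 H4]].
    assert (Hn : Re (g c) <> 0) by (intros E1; rewrite E1 in Hu; lra).
    replace (Im (g c) - Im c * (V / (10 * u0))) with
      ((Im (g1 c) - Im c * V) / (10 * Re (g c))
       + Im c * (V * (/ (10 * Re (g c)) - / (10 * u0))))
      by (rewrite (pullback_Im c E); field; auto).
    eapply Rle_trans; [apply Rabs_triang|]. rewrite (Rabs_mult (Im c)).
    assert (H5 : Rabs ((Im (g1 c) - Im c * V) / (10 * Re (g c)))
                 <= Rabs (Im (g1 c) - Im c * V) / (2 / 5)) by (apply Rabs_div_s; lra).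
    pose proof (Rmult_le_compat_l _ _ _ (Rabs_pos (Im c)) (Rlt_le _ _ H4)). lra.
  - assert (Hr : continuous (fun c => A * (/ (25 * (Re (g c) + u0)) - / (25 * (u0 + u0)))) c0).
    { cont. apply (continuous_inv_at (fun c => 25 * (Re (g c) + u0))); [cont|exact Hn2]. }
    pose proof (locally_close_to_0 _ c0 (eps / 2) Hr ltac:(cbv beta; fold u0; ring) ltac:(lra)) as Hr'.
    assert (Hb : continuous (fun c => (5 / 2 * (Rabs V + 1)) * (5 / 2 * (Rabs V + 1)) * Rabs (Im c)) c0).
    { pose proof (continuous_Im c0). cont. }
    pose proof (locally_close_to_0 _ c0 (eps / 2) Hb ltac:(cbv beta; rewrite Hc0, Rabs_R0; ring) ltac:(lra)) as Hb'.
    generalize (filter_and _ _ (filter_and _ _ Hg pullback_bounds)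
                 (filter_and _ _ H2 (filter_and _ _ Hr' Hb'))). apply filter_imp.
    intros c [[[E Hu] [H6 _]] [H3 [H4 H5]]].
    assert (Hn : Re (g c) + u0 <> 0).
    { intros E1. assert (s * (Re (g c) + u0) = 0) by (rewrite E1; ring). lra. }
    fold u0.
    replace (Re (g c) - u0 - (Re c - Re c0) * (A / (50 * u0))) with
      ((Re (g1 c) - Re (g1 c0) - (Re c - Re c0) * A) / (25 * (Re (g c) + u0))
       + (Im (g c) ^ 2 / (25 * (Re (g c) + u0))
       + (Re c - Re c0) * (A * (/ (25 * (Re (g c) + u0)) - / (25 * (u0 + u0))))))
      by (rewrite (pullback_Re c E), E0; field; repeat split; lra).
    eapply Rle_trans; [apply Rabs_triang|].
    eapply Rle_trans; [apply Rplus_le_compat_l, Rabs_triang|].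
    rewrite (Rabs_mult (Re c - Re c0)).
    assert (H7 : forall x, Rabs (x / (25 * (Re (g c) + u0))) <= Rabs x / 1)
      by (intros x; apply Rabs_div_s; lra).
    pose proof (H7 (Re (g1 c) - Re (g1 c0) - (Re c - Re c0) * A)) as H8.
    pose proof (H7 (Im (g c) ^ 2)) as H9. rewrite Rdiv_1_r in H8, H9.
    pose proof (Rmult_le_compat_l _ _ _ (Rabs_pos (Re c - Re c0)) (Rlt_le _ _ H4)) as H10.
    assert (H11 : Rabs (Im (g c) ^ 2) <= eps / 2 * Rabs (Im c)).
    { rewrite <- RPow_abs.
      apply Rle_trans with ((5 / 2 * (Rabs V + 1) * Rabs (Im c)) ^ 2).
      - apply pow_incr. split; [apply Rabs_pos|exact H6].
      - pose proof (Rle_abs (5 / 2 * (Rabs V + 1) * (5 / 2 * (Rabs V + 1)) * Rabs (Im c))).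
        replace ((5 / 2 * (Rabs V + 1) * Rabs (Im c)) ^ 2)
          with (5 / 2 * (Rabs V + 1) * (5 / 2 * (Rabs V + 1)) * Rabs (Im c) * Rabs (Im c)) by ring.
        apply Rmult_le_compat_r; [apply Rabs_pos|lra]. }
    pose proof (Rmult_le_pos _ _ (Rlt_le _ _ He) (Rabs_pos (Re c - Re c0))).
    pose proof (Rmult_le_pos _ _ (Rlt_le _ _ He) (Rabs_pos (Im c))). lra.
Qed.

End Pullback.

(** * The derivative along the shadow orbit at a real parameter *)

Section Family.
Variable psi : C -> C -> C.
Hypothesis Hpsi : forall c : C, outsideM 5 0 c -> is_bottcher 5 0 c (psi c).

Definition shadow (c : C) (j : nat) : C := psi c (orbit c j).

Lemma bottcher_of_admissible sigma n c : admissible sigma n c -> is_bottcher 5 0 c (psi c).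
Proof. intros Hc. eapply Hpsi, admissible_outsideM, Hc. Qed.

Lemma shadow_S sigma n c j : admissible sigma n c ->
  shadow c (S j) = f 5 0 (RtoC 0) (shadow c j).
Proof. intros Hc. apply (shadow_step sigma n c Hc), (bottcher_of_admissible sigma n c Hc). Qed.

Lemma Re_sub (z w : C) : Re (z - w)%C = Re z - Re w.
Proof. destruct z, w; cbn; ring. Qed.

Lemma Im_sub (z w : C) : Im (z - w)%C = Im z - Im w.
Proof. destruct z, w; cbn; ring. Qed.

(** Starting two steps after the escape time suffices because [23 ^ 2 = 529] exceeds the 500
    demanded by [shadowed]. *)
Lemma shadowed_tail sigma n c M : admissible sigma n c -> (n + 2 <= M)%nat ->
  shadowed (Re c) (Im c)
    (fun k => Re (orbit c (M + k))) (fun k => Im (orbit c (M + k)))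
    (fun k => Re (shadow c (M + k))) (fun k => Im (shadow c (M + k)))
    (fun k => qs c (M + k)).
Proof.
  intros Hc HM. pose proof (Cmod_ge_0 c) as Hc0.
  assert (Hcl : forall k, Cmod (shadow c (M + k) - orbit c (M + k))%C <= 1).
  { intros k. replace (M + k)%nat with (n + (M + k - n))%nat by lia.
    apply (shadow_close sigma n c Hc), (bottcher_of_admissible sigma n c Hc). }
  split; intros k; cbv beta; rewrite <- ?plus_n_Sm.
  - replace (M + k)%nat with (n + (2 + (M - n - 2 + k)))%nat by lia.
    pose proof (orbit_Re_ge sigma n c Hc (2 + (M - n - 2 + k))) as H1.
    assert (H2 : 2 ^ k <= 23 ^ (M - n - 2 + k)).
    { apply Rle_trans with (23 ^ k); [apply pow_incr; lra|apply Rle_pow; [lra|lia]]. }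
    rewrite pow_add in H1. cbn [pow] in H1. pose proof (two_pow_ge_1 k). nra.
  - apply orbit_Re_S.
  - apply orbit_Im_qs.
  - replace (M + k)%nat with (n + (M + k - n))%nat by lia. apply (orbit_Im_le sigma n c Hc).
  - reflexivity.
  - rewrite (shadow_S sigma n c _ Hc), f_Re. cbn; ring.
  - rewrite (shadow_S sigma n c _ Hc), f_Im. cbn; ring.
  - rewrite Rabs_minus_sym, <- Re_sub. eapply Rle_trans; [apply re_le_Cmod|apply Hcl].
  - rewrite Rabs_minus_sym, <- Im_sub. eapply Rle_trans; [apply Im_le_Cmod|apply Hcl].
Qed.

(** [1/25] is the positive fixed point of [u -> 25 u ^ 2]. The bound holds far out and descends:
    from [25 u_j ^ 2 >= u_(j+1) >= 1/25] and [u_j > 0] follows [u_j >= 1/25]. In the induction [i]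
    is the distance to the tail. *)
Lemma shadow_Re_ge sigma n c j : admissible sigma n c -> 1 / 25 <= Re (shadow c (S j)).
Proof.
  intros Hc. pose proof (bottcher_of_admissible sigma n c Hc) as Hb.
  assert (H : forall i j, (n + 2 <= S (j + i))%nat -> 1 / 25 <= Re (shadow c (S j))).
  { induction i as [|i IH]; intros j' Hj.
    - rewrite Nat.add_0_r in Hj.
      pose proof (sh_u_ge _ _ _ _ _ _ _ (shadowed_tail sigma n c _ Hc Hj) 0) as H.
      cbv beta in H. rewrite Nat.add_0_r in H. cbn [pow] in H. lra.
    - pose proof (IH (S j') ltac:(lia)) as H1.
      rewrite (shadow_S sigma n c _ Hc), f_Re in H1. cbn [Re RtoC fst] in H1.
      pose proof (shadow_Re_pos sigma n c Hc (psi c) Hb j') as H2.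
      fold (shadow c (S j')) in H2. pose proof (pow2_ge_0 (Im (shadow c (S j')))).
      nra. }
  apply (H (n + 2)%nat). lia.
Qed.

Lemma shadow_Re_0_ge sigma n c : admissible sigma n c -> 1 / 25 <= sigma * Re (shadow c 0).
Proof.
  intros Hc. pose proof (bottcher_of_admissible sigma n c Hc) as Hb.
  pose proof (shadow_Re_ge sigma n c 0 Hc) as H1.
  rewrite (shadow_S sigma n c _ Hc), f_Re in H1. cbn [Re RtoC fst] in H1.
  pose proof (shadow_Re_0 sigma n c Hc (psi c) Hb) as H2. fold (shadow c 0) in H2.
  change (psi c c) with (shadow c 0) in H2.
  pose proof (pow2_ge_0 (Im (shadow c 0))). pose proof Hc as [[->| ->] _]; nra.
Qed.

Variables (c0 : C) (sigma : R) (n : nat).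
Hypothesis Hc0 : Im c0 = 0.
Hypothesis Hadm : locally c0 (admissible sigma n).

Let adm0 : admissible sigma n c0 := locally_singleton _ _ Hadm.

Lemma shadowed_tail_real M : (n + 2 <= M)%nat ->
  shadowed (Re c0) 0
    (fun k => Re (orbit c0 (M + k))) (fun k => Im (orbit c0 (M + k)))
    (fun k => Re (shadow c0 (M + k))) (fun k => Im (shadow c0 (M + k)))
    (fun k => qs c0 (M + k)).
Proof. intros HM. rewrite <- Hc0. apply (shadowed_tail sigma n); [exact adm0|exact HM]. Qed.

Definition Uprod (M k : nat) (c : C) : R :=
  prod (fun i => 10 * Re (shadow c (M + i))) k.

Definition Wprod (M k : nat) (c : C) : R :=
  prod (fun i => 25 * (Re (shadow c (M + i)) + Re (shadow c0 (M + i)))) k.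

Definition Qbound (M : nat) (c : C) : R := 2 * (Rabs (qs c M) + 1).

Lemma shadow_Re_limit c M k : admissible sigma n c -> (n + 2 <= M)%nat ->
  Rabs (Re (shadow c M) - Re (shadow c0 M)
        - (Re c - Re c0) * (xis c0 c (M + k) / Wprod M k c))
  <= Rabs (Re c - Re c0) * ((Rabs (xis c0 c M) + 1) / 100 * (1 / 2) ^ k)
     + Im c ^ 2 * b2_const (Qbound M c) (Rabs (etas c0 c M)).
Proof.
  intros Hc HM.
  pose proof (sh_u_limit _ _ _ _ _ _ _ _ _ _ _ _ _
    (fun k => xis c0 c (M + k)) (fun k => etas c0 c (M + k))
    (shadowed_tail sigma n c M Hc HM) (shadowed_tail_real M HM)) as H.
  cbv beta in H. unfold Qbound, Wprod.
  rewrite (Nat.add_0_r M) in H. apply H.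
  - intros i. rewrite <- plus_n_Sm. reflexivity.
  - intros i. rewrite <- plus_n_Sm. reflexivity.
  - intros i. now apply orbit_Re_diff.
Qed.

Lemma shadow_Im_limit c M k : admissible sigma n c -> (n + 2 <= M)%nat ->
  Rabs (Im (shadow c M) - Im c * (qs c (M + k) / Uprod M k c))
  <= Rabs (Im c) * ((Rabs (qs c M) + 1) / 100 * (1 / 2) ^ k).
Proof.
  intros Hc HM.
  pose proof (sh_v_limit _ _ _ _ _ _ _ (shadowed_tail sigma n c M Hc HM) k) as H.
  cbv beta in H. rewrite (Nat.add_0_r M) in H. exact H.
Qed.

Lemma continuous_b2 M :
  continuous (fun c => b2_const (Qbound M c) (Rabs (etas c0 c M))) c0.
Proof.
  unfold b2_const, Qbound; cbn [pow].
  pose proof (continuous_qs M c0); pose proof (continuous_etas M c0). cont.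
Qed.

(** [shadow_Re_limit] at [k = 0] bounds the variation by a continuous function vanishing at [c0].
    The finite products [Uprod] and [Wprod] become continuous at [c0] in this way. *)
Lemma continuous_shadow_Re M : (n + 2 <= M)%nat ->
  continuous (fun c => Re (shadow c M)) c0.
Proof.
  intros HM.
  apply (continuous_squeeze _ (fun c =>
    Rabs (Re c - Re c0) * ((Rabs (xis c0 c M) + 1) / 100 * (1 / 2) ^ 0)
     + Im c * (Im c * 1) * b2_const (Qbound M c) (Rabs (etas c0 c M))
     + Rabs (Re c - Re c0) * Rabs (xis c0 c M))).
  - pose proof (continuous_Re c0); pose proof (continuous_Im c0).
    pose proof (continuous_b2 M); pose proof (continuous_xis M c0).
    unfold Rdiv. cont.
  - rewrite Hc0. unfold Rminus. rewrite Rplus_opp_r, Rabs_R0. ring.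
  - generalize Hadm. apply filter_imp. intros c Hc.
    pose proof (shadow_Re_limit c M 0 Hc HM) as H.
    unfold Wprod in H. cbn [prod] in H. rewrite Nat.add_0_r, Rdiv_1_r in H.
    replace (Re (shadow c M) - Re (shadow c0 M)) with
      ((Re (shadow c M) - Re (shadow c0 M) - (Re c - Re c0) * xis c0 c M)
       + (Re c - Re c0) * xis c0 c M) by ring.
    eapply Rle_trans; [apply Rabs_triang|]. rewrite (Rabs_mult _ (xis c0 c M)).
    cbn [pow] in H |- *. lra.
Qed.

Lemma continuous_prod (w : nat -> C -> R) k :
  (forall i, continuous (w i) c0) -> continuous (fun c => prod (fun i => w i c) k) c0.
Proof.
  intros Hw. induction k as [|k IH]; cbn [prod]; [apply continuous_const|].
  apply (continuous_mult (K := R_AbsRing)); [exact IH|exact (Hw k)].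
Qed.

Lemma continuous_Q M k : (n + 2 <= M)%nat ->
  continuous (fun c => qs c (M + k) / Uprod M k c) c0.
Proof.
  intros HM. unfold Rdiv.
  apply (continuous_mult (K := R_AbsRing)); [apply continuous_qs|].
  apply (continuous_inv_at (Uprod M k)).
  - apply (continuous_prod (fun i c => 10 * Re (shadow c (M + i)))). intros i.
    apply (continuous_mult (K := R_AbsRing)); [apply continuous_const|].
    apply continuous_shadow_Re. lia.
  - pose proof (sh_U_ge _ _ _ _ _ _ _ (shadowed_tail_real M HM) k).
    pose proof (two_pow_ge_1 k). unfold Uprod. lra.
Qed.

Lemma continuous_Xi M k : (n + 2 <= M)%nat ->
  continuous (fun c => xis c0 c (M + k) / Wprod M k c) c0.
Proof.
  intros HM. unfold Rdiv.
  apply (continuous_mult (K := R_AbsRing)); [apply continuous_xis|].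
  apply (continuous_inv_at (Wprod M k)).
  - apply (continuous_prod (fun i c => 25 * (Re (shadow c (M + i)) + Re (shadow c0 (M + i))))).
    intros i.
    apply (continuous_mult (K := R_AbsRing)); [apply continuous_const|].
    apply (continuous_plus (V := R_NormedModule)); [|apply continuous_const].
    apply continuous_shadow_Re. lia.
  - pose proof (sh_W_ge _ _ _ _ _ _ _ _ _ _ _ _ _ (shadowed_tail_real M HM)
      (shadowed_tail_real M HM) k).
    pose proof (two_pow_ge_1 k). unfold Wprod. lra.
Qed.

Lemma locally_Rabs_le (g : C -> R) : continuous g c0 ->
  locally c0 (fun c => Rabs (g c) <= Rabs (g c0) + 1).
Proof.
  intros Hg. generalize (continuous_locally_lt g c0 Hg 1 Rlt_0_1).
  apply filter_imp. intros c H. pose proof (Rabs_triang_inv (g c) (g c0)). lra.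
Qed.

(** [A] and [V] are the limits of the normalized [xis] and [qs] at [c0]. For given [eps] a fixed
    large [k] makes the tail of the limit small, after which only the continuity in [c] of the
    quotients at index [k] is needed. *)
Lemma shadow_real_diff_tail M (s : R) : (n + 2 <= M)%nat -> s = 1 \/ s = -1 ->
  1 <= s * xis c0 c0 M -> 1 <= qs c0 M ->
  exists A V, real_diff c0 (fun c => shadow c M) A V /\ 0 < s * A * V.
Proof.
  intros HM Hs Hxi Hq.
  set (Qk := fun k c => qs c (M + k) / Uprod M k c).
  set (Xk := fun k c => xis c0 c (M + k) / Wprod M k c).
  set (KQ := fun c => (Rabs (qs c M) + 1) / 100).
  set (KX := fun c => (Rabs (xis c0 c M) + 1) / 100).
  destruct (geometric_limit (fun k => Qk k c0) (KQ c0)) as [V HV].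
  { intros k j. pose proof (sh_Q_cauchy _ _ _ _ _ _ _ (shadowed_tail_real M HM) k j) as H.
    cbv beta in H. rewrite (Nat.add_0_r M) in H. exact H. }
  destruct (geometric_limit (fun k => Xk k c0) (KX c0)) as [A HA].
  { intros k j.
    pose proof (xi_cauchy _ _ _ _ _ _ _ _ _ _ _ _ _ (fun k => xis c0 c0 (M + k))
      (shadowed_tail_real M HM) (shadowed_tail_real M HM)) as H.
    cbv beta in H. rewrite (Nat.add_0_r M) in H. apply H.
    intros i. rewrite <- plus_n_Sm. reflexivity. }
  exists A, V. split.
  - intros eps He. split.
    + destruct (half_pow_small (KQ c0 + 1) (eps / 3)) as [k Hk]; [lra|].
      pose proof (continuous_locally_lt _ c0 (continuous_Q M k HM) (eps / 3) ltac:(lra)) as H1.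
      pose proof (locally_Rabs_le _ (continuous_qs M c0)) as H2.
      generalize (filter_and _ _ Hadm (filter_and _ _ H1 H2)). apply filter_imp.
      intros c [Hc [H3 H4]]. cbv beta in H3, H4.
      fold (Qk k c) in H3. fold (Qk k c0) in H3.
      pose proof (shadow_Im_limit c M k Hc HM) as H5. fold (Qk k c) in H5.
      fold (KQ c) in H5.
      pose proof (HV k) as H6. cbv beta in H6. pose proof (half_pow_pos k) as H7.
      assert (H8 : KQ c * (1 / 2) ^ k <= eps / 3).
      { unfold KQ in *. nra. }
      assert (H9 : Rabs (V - Qk k c0) <= eps / 3) by lra.
      assert (H10 : Rabs (Qk k c - V) <= 2 / 3 * eps).
      { apply Rabs_le_between in H9. apply Rabs_def2 in H3. apply Rabs_le_between. lra. }
      replace (Im (shadow c M) - Im c * V)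
        with ((Im (shadow c M) - Im c * Qk k c) + Im c * (Qk k c - V)) by ring.
      eapply Rle_trans; [apply Rabs_triang|]. rewrite (Rabs_mult (Im c)).
      pose proof (Rmult_le_compat_l _ _ _ (Rabs_pos (Im c)) H8).
      pose proof (Rmult_le_compat_l _ _ _ (Rabs_pos (Im c)) H10). lra.
    + destruct (half_pow_small (KX c0 + 1) (eps / 3)) as [k Hk]; [lra|].
      pose proof (continuous_locally_lt _ c0 (continuous_Xi M k HM) (eps / 3) ltac:(lra)) as H1.
      pose proof (locally_Rabs_le _ (continuous_xis M c0)) as H2.
      assert (Hb : continuous (fun c => Im c * b2_const (Qbound M c) (Rabs (etas c0 c M))) c0).
      { pose proof (continuous_b2 M); pose proof (continuous_Im c0). cont. }
      pose proof (locally_close_to_0 _ c0 eps Hb ltac:(cbv beta; rewrite Hc0; ring) He) as Hb'.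
      generalize (filter_and _ _ (filter_and _ _ Hadm Hb') (filter_and _ _ H1 H2)).
      apply filter_imp.
      intros c [[Hc H0] [H3 H4]]. cbv beta in H3, H4.
      fold (Xk k c) in H3. fold (Xk k c0) in H3.
      pose proof (shadow_Re_limit c M k Hc HM) as H5. fold (Xk k c) in H5.
      fold (KX c) in H5.
      pose proof (HA k) as H6. cbv beta in H6. pose proof (half_pow_pos k) as H7.
      assert (H8 : KX c * (1 / 2) ^ k <= eps / 3).
      { unfold KX in *. nra. }
      assert (H9 : Rabs (A - Xk k c0) <= eps / 3) by lra.
      assert (H10 : Rabs (Xk k c - A) <= 2 / 3 * eps).
      { apply Rabs_le_between in H9. apply Rabs_def2 in H3. apply Rabs_le_between. lra. }
      replace (Re (shadow c M) - Re (shadow c0 M) - (Re c - Re c0) * A)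
        with ((Re (shadow c M) - Re (shadow c0 M) - (Re c - Re c0) * Xk k c)
              + (Re c - Re c0) * (Xk k c - A)) by ring.
      eapply Rle_trans; [apply Rabs_triang|]. rewrite (Rabs_mult (Re c - Re c0)).
      pose proof (Rmult_le_compat_l _ _ _ (Rabs_pos (Re c - Re c0)) H8).
      pose proof (Rmult_le_compat_l _ _ _ (Rabs_pos (Re c - Re c0)) H10).
      set (E := b2_const (Qbound M c) (Rabs (etas c0 c M))) in *.
      assert (H13 : Im c ^ 2 * E <= Rabs (Im c) * eps).
      { eapply Rle_trans; [apply Rle_abs|].
        replace (Im c ^ 2 * E) with (Im c * (Im c * E)) by ring. rewrite Rabs_mult.
        apply Rmult_le_compat_l; [apply Rabs_pos|lra]. }
      lra.
  (* At [k = 0] both products are 1, so [V] and [A] differ from [qs] and [xis] at index [M] by about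
     one percent and inherit their signs. *)
  - pose proof (HV 0%nat) as H1; pose proof (HA 0%nat) as H2.
    unfold Qk, Xk, Uprod, Wprod, KQ, KX in H1, H2. cbn [prod pow] in H1, H2.
    rewrite Nat.add_0_r, Rdiv_1_r in H1, H2. apply Rabs_le_between in H1, H2.
    rewrite (Rabs_pos_eq (qs c0 M)) in H1 by lra.
    assert (HV' : 0 < V) by lra.
    assert (HA' : 0 < s * A).
    { destruct Hs as [->| ->].
      - rewrite (Rabs_pos_eq (xis c0 c0 M)) in H2 by lra. lra.
      - rewrite (Rabs_left1 (xis c0 c0 M)) in H2 by lra. lra. }
    nra.
Qed.

(** Descending from index [M] to 0, each pullback divides [A] by [50 w] and [V] by [10 w] with the
    same [w], so the sign of [A * V] is unchanged even where [w] is negative. *)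
Lemma shadow_real_diff M (s : R) : (n + 2 <= M)%nat -> s = 1 \/ s = -1 ->
  1 <= s * xis c0 c0 M -> 1 <= qs c0 M ->
  exists A V, real_diff c0 (fun c => psi c c) A V /\ 0 < s * A * V.
Proof.
  intros HM Hs Hxi Hq.
  assert (H : forall i, (i <= M)%nat ->
    exists A V, real_diff c0 (fun c => shadow c (M - i)) A V /\ 0 < s * A * V).
  { induction i as [|i IH]; intros Hi.
    - rewrite Nat.sub_0_r. now apply shadow_real_diff_tail.
    - destruct IH as (A & V & Hd & HAV); [lia|].
      set (j := (M - S i)%nat). replace (M - i)%nat with (S j) in Hd by (unfold j; lia).
      assert (Hg : exists t, (t = 1 \/ t = -1) /\ locally c0 (fun c =>
        shadow c (S j) = f 5 0 (RtoC 0) (shadow c j) /\ 1 / 25 <= t * Re (shadow c j))).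
      { destruct j as [|j'].
        - exists sigma. split; [apply adm0|]. generalize Hadm. apply filter_imp.
          intros c Hc. split; [now apply (shadow_S sigma n)|now apply (shadow_Re_0_ge sigma n)].
        - exists 1. split; [now left|]. generalize Hadm. apply filter_imp.
          intros c Hc. split; [now apply (shadow_S sigma n)|].
          rewrite Rmult_1_l. now apply (shadow_Re_ge sigma n). }
      destruct Hg as (t & Ht & Hg).
      exists (A / (50 * Re (shadow c0 j))), (V / (10 * Re (shadow c0 j))). split.
      + apply (real_diff_pullback c0 (fun c => shadow c j) (fun c => shadow c (S j)) t);
          assumption.
      + destruct (locally_singleton _ _ Hg) as [_ H1].
        set (w := Re (shadow c0 j)) in *.
        assert (Hw : w <> 0) by (intros E; rewrite E in H1; lra).
        replace (s * (A / (50 * w)) * (V / (10 * w)))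
          with (s * A * V * / (500 * w ^ 2)) by (field; exact Hw).
        apply Rmult_lt_0_compat; [exact HAV|]. apply Rinv_0_lt_compat.
        pose proof (pow2_gt_0 w Hw). lra. }
  specialize (H M (le_n M)). rewrite Nat.sub_diag in H. exact H.
Qed.

End Family.

(** * The parameters of the theorem *)

Lemma sector_neg x (c : C) : x <= - Re c -> Rabs (Im c) <= - Re c / 10 ->
  sector x (RtoC (-1) * c)%C.
Proof.
  intros H1 H2. apply Rabs_le_between in H2.
  destruct c as [a b]; unfold sector; cbn [Re Im Cmult RtoC fst snd] in *.
  split; [lra|]. apply Rabs_le_between. lra.
Qed.

Lemma admissible_left_2 (c : C) : -14 / 100 <= Re c <= -13 / 100 ->
  Rabs (Im c) <= 1 / 1000 -> admissible (-1) 2 c.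
Proof.
  intros Ha Hb. pose proof (Cmod_le_Re_Im c) as Hc.
  rewrite (Rabs_left1 (Re c)) in Hc by lra. pose proof (Cmod_ge_0 c) as Hc0.
  split; [now right|]. split; [lia|]. split.
  - exists (- Re c). split; [lra|]. split; [apply sector_neg; lra|].
    cbn [good]. set (a := Re c) in *.
    assert (H1 : 29 / 100 <= 2499 / 100 * (- a) ^ 2 + a) by nra.
    set (x1 := 2499 / 100 * (- a) ^ 2 + a) in *.
    repeat split; nra.
  - intros [|[|j]] Hj; [change (orbit c 0) with c; lra| |lia].
    eapply Rle_trans; [apply Cmod_le_Re_Im|]. rewrite orbit_Re_S, orbit_Im_S.
    change (orbit c 0) with c. apply Rabs_le_between in Hb.
    assert (Rabs (25 * Re c ^ 2 - Im c ^ 2 + Re c) <= 1 / 2) by (apply Rabs_le_between; nra).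
    assert (Rabs (10 * Re c * Im c + Im c) <= 1 / 2) by (apply Rabs_le_between; nra).
    lra.
Qed.

Lemma admissible_left_3 (c : C) : -101 / 1000 <= Re c <= -99 / 1000 ->
  Rabs (Im c) <= 1 / 1000 -> admissible (-1) 3 c.
Proof.
  intros Ha Hb. pose proof (Cmod_le_Re_Im c) as Hc.
  rewrite (Rabs_left1 (Re c)) in Hc by lra. pose proof (Cmod_ge_0 c) as Hc0.
  split; [now right|]. split; [lia|]. split.
  - exists (99 / 1000). split; [lra|]. split; [apply sector_neg; lra|].
    cbn [good]. set (a := Re c) in *.
    (* The lower bounds run through 0.099, 0.14, 0.38, and the third image exceeds 3, beyond
       [1 + |c|]. *)
    assert (H1 : 14 / 100 <= 2499 / 100 * (99 / 1000) ^ 2 + a) by lra.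
    set (x1 := 2499 / 100 * (99 / 1000) ^ 2 + a) in *.
    assert (H2 : 38 / 100 <= 2499 / 100 * x1 ^ 2 + a) by nra.
    set (x2 := 2499 / 100 * x1 ^ 2 + a) in *.
    repeat split; nra.
  - apply Rabs_le_between in Hb.
    assert (H1 : 0 <= Re (orbit c 1) <= 2 / 10 /\ -1 / 100 <= Im (orbit c 1) <= 1 / 100).
    { rewrite orbit_Re_S, orbit_Im_S. change (orbit c 0) with c.
      assert (98 / 10000 <= Re c ^ 2 <= 103 / 10000) by nra.
      assert (Im c ^ 2 <= 1 / 1000) by nra. repeat split; nra. }
    assert (H2 : -1 / 2 <= Re (orbit c 2) <= 95 / 100 /\ -5 / 100 <= Im (orbit c 2) <= 5 / 100).
    { rewrite (orbit_Re_S c 1), (orbit_Im_S c 1). destruct H1.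
      assert (Re (orbit c 1) ^ 2 <= 4 / 100) by nra.
      assert (Im (orbit c 1) ^ 2 <= 1 / 1000) by nra.
      assert (-2 / 1000 <= Re (orbit c 1) * Im (orbit c 1) <= 2 / 1000) by (split; nra).
      repeat split; nra. }
    intros [|[|[|j]]] Hj; [change (orbit c 0) with c; lra| | |lia];
      (eapply Rle_trans; [apply Cmod_le_Re_Im|]).
    + assert (Rabs (Re (orbit c 1)) <= 2 / 10) by (apply Rabs_le_between; lra).
      assert (Rabs (Im (orbit c 1)) <= 1 / 100) by (apply Rabs_le_between; lra). lra.
    + assert (Rabs (Re (orbit c 2)) <= 95 / 100) by (apply Rabs_le_between; lra).
      assert (Rabs (Im (orbit c 2)) <= 5 / 100) by (apply Rabs_le_between; lra). lra.
Qed.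

Lemma admissible_right (c : C) : 1 / 2 <= Re c -> Rabs (Im c) <= 1 / 100 ->
  admissible 1 1 c.
Proof.
  intros Ha Hb. pose proof (Cmod_le_Re_Im c) as Hc.
  rewrite (Rabs_pos_eq (Re c)) in Hc by lra. pose proof (Cmod_ge_0 c) as Hc0.
  split; [now left|]. split; [lia|]. split.
  - exists (1 / 2). split; [lra|]. split.
    + replace (RtoC 1 * c)%C with c by ring. split; lra.
    + cbn [good]. repeat split; lra.
  - intros [|j] Hj; [change (orbit c 0) with c; lra|lia].
Qed.

Lemma locally_box (c0 : C) (eps : posreal) (P : C -> Prop) :
  (forall c, Rabs (Re c - Re c0) < eps -> Rabs (Im c - Im c0) < eps -> P c) ->
  locally c0 P.
Proof. intros H. exists eps. intros c [H1 H2]. now apply H. Qed.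

Section Main.
Variable psi : C -> C -> C.
Hypothesis Hpsi : forall c : C, outsideM 5 0 c -> is_bottcher 5 0 c (psi c).

(** * Signs of the determinant *)

Lemma derivative_of_real_diff c0 A V : Im c0 = 0 -> real_diff c0 (fun c => psi c c) A V ->
  exists L, has_real_derivative (fun c => psi c c) c0 L /\ det L = A * V.
Proof.
  intros H0 Hd. eexists; split; [apply (real_diff_has_real_derivative _ _ _ _ H0 Hd)|].
  unfold det; cbn; ring.
Qed.

Lemma det_negative_at_minus_tenth :
  exists L, has_real_derivative (fun c => psi c c) (RtoC (-1 / 10)) L /\ det L < 0.
Proof.
  set (c0 := RtoC (-1 / 10)).
  assert (Hadm : locally c0 (admissible (-1) 3)).
  { apply (locally_box c0 (mkposreal (1 / 1000) ltac:(lra))).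
    intros c H1 H2. cbn [pos c0 RtoC Re Im fst snd] in H1, H2.
    apply Rabs_def2 in H1. rewrite Rminus_0_r in H2. apply admissible_left_3; lra. }
  assert (E0 : Im c0 = 0) by reflexivity. assert (E1 : Re c0 = -1 / 10) by reflexivity.
  assert (HI : forall j, Im (orbit c0 j) = 0) by (intros j; rewrite orbit_Im_qs, E0; ring).
  assert (X0 : Re (orbit c0 0) = -1 / 10) by reflexivity.
  assert (X1 : Re (orbit c0 1) = 15 / 100) by (rewrite orbit_Re_S, HI, X0, E1; lra).
  assert (X2 : 4 / 10 <= Re (orbit c0 2)) by (rewrite orbit_Re_S, HI, X1, E1; lra).
  assert (X3 : 1 <= Re (orbit c0 3)) by (rewrite orbit_Re_S, HI, E1; nra).
  assert (X4 : 1 <= Re (orbit c0 4)) by (rewrite orbit_Re_S, HI, E1; nra).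
  (* The index 5 is [n + 2] for the escape time [n = 3]. The last argument is the sign of [xis],
     which takes the values 1, -4, -29 and then stays below -1, whereas [qs] runs through 1, 0, 1
     and stays at least 1. *)
  destruct (shadow_real_diff psi Hpsi c0 (-1) 3 E0 Hadm 5 (-1)) as (A & V & Hd & HAV).
  - lia.
  - now right.
  - cbn [xis].
    set (x2 := Re (orbit c0 2)) in *; set (x3 := Re (orbit c0 3)) in *;
      set (x4 := Re (orbit c0 4)) in *. rewrite X0, X1.
    match goal with |- context [25 * (x3 + x3) * ?t + 1] => assert (H1 : t <= -1) by nra;
      set (t1 := t) in * end.
    assert (H2 : 25 * (x3 + x3) * t1 + 1 <= -1) by nra.
    set (t2 := 25 * (x3 + x3) * t1 + 1) in *. nra.
  - cbn [qs].
    set (x2 := Re (orbit c0 2)) in *; set (x3 := Re (orbit c0 3)) in *;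
      set (x4 := Re (orbit c0 4)) in *. rewrite X0, X1.
    match goal with |- context [10 * x3 * ?t + 1] => assert (H1 : 1 <= t) by nra;
      set (t1 := t) in * end.
    assert (H2 : 1 <= 10 * x3 * t1 + 1) by nra.
    set (t2 := 10 * x3 * t1 + 1) in *. nra.
  - destruct (derivative_of_real_diff c0 A V E0 Hd) as (L & HL & HdetL).
    exists L. split; [exact HL|]. lra.
Qed.

Lemma det_positive_right (a : R) : 1 <= a ->
  exists L, has_real_derivative (fun c => psi c c) (RtoC a) L /\ 0 < det L.
Proof.
  intros Ha. set (c0 := RtoC a).
  assert (Hadm : locally c0 (admissible 1 1)).
  { apply (locally_box c0 (mkposreal (1 / 100) ltac:(lra))).
    intros c H1 H2. cbn [pos c0 RtoC Re Im fst snd] in H1, H2.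
    apply Rabs_def2 in H1. rewrite Rminus_0_r in H2. apply admissible_right; lra. }
  assert (E0 : Im c0 = 0) by reflexivity. assert (E1 : Re c0 = a) by reflexivity.
  assert (HI : forall j, Im (orbit c0 j) = 0) by (intros j; rewrite orbit_Im_qs, E0; ring).
  assert (HX : forall j, 1 <= Re (orbit c0 j)).
  { induction j as [|j IH]; [exact Ha|]. rewrite orbit_Re_S, HI, E1. nra. }
  assert (Hq : forall j, 1 <= qs c0 j).
  { induction j as [|j IH]; cbn [qs]; [lra|]. pose proof (HX j). nra. }
  assert (Hxi : forall j, 1 <= xis c0 c0 j).
  { induction j as [|j IH]; cbn [xis]; [lra|]. pose proof (HX j). nra. }
  destruct (shadow_real_diff psi Hpsi c0 1 1 E0 Hadm 3 1) as (A & V & Hd & HAV).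
  - lia.
  - now left.
  - rewrite Rmult_1_l. apply Hxi.
  - apply Hq.
  - destruct (derivative_of_real_diff c0 A V E0 Hd) as (L & HL & HdetL).
    exists L. split; [exact HL|]. lra.
Qed.

(** * Parameters whose orbit has bounded imaginary part *)

Lemma eq_0_of_pow_bound x : (forall k, Rabs x * 2 ^ k <= 2) -> x = 0.
Proof.
  intros H. apply Rabs_0_eq. apply Rle_of_half_pow with 2. intros k.
  pose proof (H k) as H1. pose proof (two_pow_ge_1 k). rewrite half_pow_eq.
  apply Rmult_le_reg_r with (2 ^ k); [lra|].
  replace ((0 + 2 * / 2 ^ k) * 2 ^ k) with 2 by (field; lra). exact H1.
Qed.

(** In the tail [v_(j+k)] is [v_j] times a factor of at least [2 ^ k], yet at most 2 in modulus, so
    [v_j = 0]. Earlier indices follow from [v_(j+1) = 10 u_j v_j] with [u_j] nonzero. *)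
Lemma shadow_Im_0 sigma n c : admissible sigma n c ->
  (forall j, (n <= j)%nat -> Rabs (Im (orbit c j)) <= 1) ->
  forall j, Im (shadow psi c j) = 0.
Proof.
  intros Hc HI.
  assert (H : forall i j, (n + 2 <= j + i)%nat -> Im (shadow psi c j) = 0).
  { induction i as [|i IH]; intros j Hj.
    - pose proof (shadowed_tail psi Hpsi sigma n c j Hc ltac:(lia)) as Hs.
      apply eq_0_of_pow_bound. intros k.
      pose proof (shyv _ _ _ _ _ _ _ Hs k) as H1; pose proof (HI (j + k)%nat ltac:(lia)) as H2.
      pose proof (sh_v_prod _ _ _ _ _ _ _ Hs k) as H3.
      pose proof (sh_U_ge _ _ _ _ _ _ _ Hs k) as H4. cbv beta in H1, H3.
      rewrite (Nat.add_0_r j) in H3.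
      set (U := prod _ k) in *.
      assert (H5 : Rabs (Im (shadow psi c (j + k))) <= 2).
      { apply Rabs_le_between in H1, H2. apply Rabs_le_between. lra. }
      rewrite H3, Rabs_mult in H5. pose proof (two_pow_ge_1 k).
      rewrite (Rabs_pos_eq U) in H5 by lra.
      eapply Rle_trans; [|exact H5]. apply Rmult_le_compat_l; [apply Rabs_pos|exact H4].
    - pose proof (IH (S j) ltac:(lia)) as H1.
      rewrite (shadow_S psi Hpsi sigma n c _ Hc), f_Im in H1. change (Im (RtoC 0)) with 0 in H1.
      assert (H2 : Re (shadow psi c j) <> 0).
      { destruct j as [|j'].
        - pose proof (shadow_Re_0_ge psi Hpsi sigma n c Hc) as H2.
          intros E; rewrite E in H2; lra.
        - pose proof (shadow_Re_ge psi Hpsi sigma n c j' Hc). lra. }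
      nra. }
  intros j. apply (H (n + 2)%nat). lia.
Qed.

(* Two real [f_0]-orbits that stay at bounded distance coincide, because [f_0]
   expands there. *)
Lemma shadow_real_eq sigma n c c' : admissible sigma n c -> admissible sigma n c' ->
  (forall j, Re (orbit c j) = Re (orbit c' j)) ->
  (forall j, (n <= j)%nat -> Rabs (Im (orbit c j)) <= 1) ->
  (forall j, (n <= j)%nat -> Rabs (Im (orbit c' j)) <= 1) ->
  psi c c = psi c' c'.
Proof.
  intros Hc Hc' HR HI HI'.
  pose proof (shadow_Im_0 sigma n c Hc HI) as Z; pose proof (shadow_Im_0 sigma n c' Hc' HI') as Z'.
  set (d := fun j => Re (shadow psi c j) - Re (shadow psi c' j)).
  assert (Hd : forall j, d (S j) = 25 * (Re (shadow psi c j) + Re (shadow psi c' j)) * d j).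
  { intros j. unfold d. rewrite (shadow_S psi Hpsi sigma n c _ Hc),
      (shadow_S psi Hpsi sigma n c' _ Hc'), !f_Re, Z, Z'. cbn [RtoC Re fst]. ring. }
  assert (H : forall i j, (n + 2 <= j + i)%nat -> d j = 0).
  { induction i as [|i IH]; intros j Hj.
    - pose proof (shadowed_tail psi Hpsi sigma n c j Hc ltac:(lia)) as Hs.
      pose proof (shadowed_tail psi Hpsi sigma n c' j Hc' ltac:(lia)) as Hs'.
      apply eq_0_of_pow_bound. intros k.
      apply Rle_trans with (Rabs (d (j + k)%nat)).
      + induction k as [|k IHk].
        * rewrite Nat.add_0_r. cbn [pow]. lra.
        * rewrite <- plus_n_Sm, Hd, Rabs_mult.
          pose proof (sh_u_ge _ _ _ _ _ _ _ Hs k) as H1;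
            pose proof (sh_u_ge _ _ _ _ _ _ _ Hs' k) as H2; cbv beta in H1, H2.
          pose proof (two_pow_ge_1 k). rewrite (Rabs_pos_eq (25 * _)) by lra.
          pose proof (Rabs_pos (d (j + k)%nat)). cbn [pow]. nra.
      + pose proof (shxu _ _ _ _ _ _ _ Hs k) as H1;
          pose proof (shxu _ _ _ _ _ _ _ Hs' k) as H2; cbv beta in H1, H2.
        rewrite HR in H1. apply Rabs_le_between in H1, H2.
        apply Rabs_le_between. unfold d. lra.
    - pose proof (IH (S j) ltac:(lia)) as H1. rewrite Hd in H1.
      assert (H2 : Re (shadow psi c j) + Re (shadow psi c' j) <> 0).
      { destruct j as [|j'].
        - pose proof (shadow_Re_0_ge psi Hpsi sigma n c Hc) as H2.
          pose proof (shadow_Re_0_ge psi Hpsi sigma n c' Hc') as H3.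
          intros E. assert (sigma * (Re (shadow psi c 0) + Re (shadow psi c' 0)) = 0)
            by (rewrite E; ring). lra.
        - pose proof (shadow_Re_ge psi Hpsi sigma n c j' Hc).
          pose proof (shadow_Re_ge psi Hpsi sigma n c' j' Hc'). lra. }
      nra. }
  change (shadow psi c 0 = shadow psi c' 0).
  apply C_eq; [|now rewrite Z, Z'].
  pose proof (H (n + 2)%nat 0%nat ltac:(lia)) as H1. unfold d in H1. lra.
Qed.

End Main.

Lemma orbit_conj_Re_Im c j :
  Re (orbit (Cconj c) j) = Re (orbit c j) /\ Im (orbit (Cconj c) j) = - Im (orbit c j).
Proof.
  induction j as [|j [H1 H2]]; [now destruct c|].
  rewrite !orbit_Re_S, !orbit_Im_S, H1, H2. destruct c; cbn; split; ring.
Qed.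

(** * A conjugate pair of parameters with the same value of [Psi] *)

Section Segment.
Let b := 1 / 1000.
Let yy (j : nat) (a : R) : R := Im (orbit (a, b) j).
Let lo := -14 / 100.
Let hi := -13 / 100.

Lemma b_eq : b = 1 / 1000. Proof. reflexivity. Qed.

Lemma segment_admissible a : lo <= a <= hi -> admissible (-1) 2 (a, b).
Proof.
  intros Ha. apply admissible_left_2; [exact Ha|].
  cbn; unfold b. rewrite Rabs_pos_eq; lra.
Qed.

Lemma segment_Re_ge a j : lo <= a <= hi -> (2 <= j)%nat -> 1 <= Re (orbit (a, b) j).
Proof.
  intros Ha Hj. pose proof (orbit_Re_ge (-1) 2 _ (segment_admissible a Ha) (j - 2)) as H.
  replace (2 + (j - 2))%nat with j in H by lia.
  pose proof (Cmod_ge_0 (a, b)).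
  assert (1 <= 23 ^ (j - 2)) by (apply pow_R1_Rle; lra). nra.
Qed.

Lemma yy_S j a : yy (S j) a = 10 * Re (orbit (a, b) j) * yy j a + b.
Proof. exact (orbit_Im_S (a, b) j). Qed.

(** One step is [y -> 10 x y + b] with [x >= 1] and [b > 0]: it preserves [y > 0] and sends
    [y < - b] below [- 9 b]. So the two ways of leaving [[- b, 0]] exclude each other, whatever the
    indices. *)
Lemma yy_pos_stable a i j : lo <= a <= hi -> (2 <= i <= j)%nat -> 0 < yy i a -> 0 < yy j a.
Proof.
  intros Ha [Hi Hij] H. induction Hij as [|j Hij IH]; [exact H|].
  rewrite yy_S. pose proof (segment_Re_ge a j Ha ltac:(lia)). pose proof b_eq. nra.
Qed.

Lemma yy_neg_stable a i j : lo <= a <= hi -> (2 <= i <= j)%nat -> yy i a < - b -> yy j a < - b.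
Proof.
  intros Ha [Hi Hij] H. induction Hij as [|j Hij IH]; [exact H|].
  rewrite yy_S. pose proof (segment_Re_ge a j Ha ltac:(lia)). pose proof b_eq. nra.
Qed.

Lemma yy_exclusive a i j : lo <= a <= hi -> (2 <= i)%nat -> (2 <= j)%nat ->
  0 < yy i a -> yy j a < - b -> False.
Proof.
  intros Ha Hi Hj H1 H2.
  pose proof (yy_pos_stable a i (i + j) Ha ltac:(lia) H1).
  pose proof (yy_neg_stable a j (i + j) Ha ltac:(lia) H2). pose proof b_eq. lra.
Qed.

Lemma yy_locally j a eps : 0 < eps ->
  exists d, 0 < d /\ forall a', Rabs (a' - a) < d -> Rabs (yy j a' - yy j a) < eps.
Proof.
  intros He.
  assert (Hc : continuous (fun a => yy j a) a).
  { apply (continuous_comp (fun a : R => (a, b) : C) (fun c => Im (orbit c j))).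
    - apply continuous_C; [apply continuous_id|apply continuous_const].
    - apply continuous_orbit_Re_Im. }
  destruct (proj1 (filterlim_locally _ _) Hc (mkposreal eps He)) as [d Hd].
  exists d. split; [apply cond_pos|]. exact Hd.
Qed.

(** At [a = -13/100] the imaginary parts are [b], [-0.3 b], [0.1225 b]. *)
Lemma yy_hi : 0 < yy 2 hi.
Proof.
  rewrite !yy_S, orbit_Re_S. unfold yy. change (orbit (hi, b) 0) with ((hi, b) : C).
  cbn [Re Im fst snd]. unfold hi, b. lra.
Qed.

(** At [a = -14/100] they are [b], [-0.4 b], [-0.4 b], and one more step with real part at least 1
    goes below [- b]. *)
Lemma yy_lo : yy 3 lo < - b.
Proof.
  assert (H : yy 2 lo < - b / 4).
  { rewrite !yy_S, orbit_Re_S. unfold yy. change (orbit (lo, b) 0) with ((lo, b) : C).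
    cbn [Re Im fst snd]. unfold lo, b. lra. }
  rewrite yy_S. pose proof (segment_Re_ge lo 2 ltac:(unfold lo, hi; lra) (le_n 2)).
  pose proof b_eq. nra.
Qed.

(* The parameters with [yy j a > 0] for some [j] and those with
   [yy j a < - b] for some [j] form two disjoint open sets, so they do not
   cover the segment. *)
Lemma bounded_imaginary_orbit :
  exists a, lo <= a <= hi /\ forall j, (2 <= j)%nat -> - b <= yy j a <= 0.
Proof.
  (* Connectedness of the segment is used through the supremum of the set of parameters that leave
     downwards. *)
  set (E := fun a => lo <= a <= hi /\ exists j, (2 <= j)%nat /\ yy j a < - b).
  assert (Hlo : E lo).
  { split; [unfold lo, hi; lra|]. exists 3%nat. split; [lia|exact yy_lo]. }
  destruct (completeness E) as [a [Hub Hlub]].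
  { exists hi. intros a [Ha _]. lra. }
  { exists lo. exact Hlo. }
  assert (Ha : lo <= a <= hi).
  { split; [now apply Hub|]. apply Hlub. intros x [Hx _]. lra. }
  exists a. split; [exact Ha|]. intros j Hj. split; apply Rnot_lt_le; intros H.
  (* If the supremum itself left downwards, so would some slightly larger parameter. *)
  - assert (Hne : a <> hi).
    { intros E0. apply (yy_exclusive a 2 j Ha); auto. rewrite E0. exact yy_hi. }
    destruct (yy_locally j a (- b - yy j a)) as (d & Hd & H1); [lra|].
    set (a' := Rmin hi (a + d / 2)).
    assert (Ha' : a < a' <= hi /\ a' <= a + d / 2).
    { unfold a'. pose proof (Rmin_l hi (a + d / 2)); pose proof (Rmin_r hi (a + d / 2)).
      split; [split|]; try lra. apply Rmin_glb_lt; lra. }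
    assert (H2 : a' <= a); [|lra]. apply Hub. split; [lra|]. exists j. split; [exact Hj|].
    assert (H3 : Rabs (a' - a) < d) by (apply Rabs_def1; lra).
    apply H1, Rabs_def2 in H3. lra.
  (* If it left upwards, so would everything close to it, and [a - d / 2] would be a smaller upper
     bound. *)
  - destruct (yy_locally j a (yy j a)) as (d & Hd & H1); [lra|].
    assert (H2 : a <= a - d / 2); [|lra].
    apply Hlub. intros e He. apply Rnot_lt_le. intros H3.
    pose proof (Hub e He) as H4. destruct He as [He (i & Hi & H5)].
    apply (yy_exclusive e j i He); auto.
    assert (H6 : Rabs (e - a) < d) by (apply Rabs_def1; lra).
    apply H1, Rabs_def2 in H6. lra.
Qed.

(** The parameter found above and its conjugate share their real parts along the orbit, so
    [shadow_real_eq] gives them one value; they are distinct because [b] is nonzero. *)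
Lemma not_injective (psi : C -> C -> C) :
  (forall c : C, outsideM 5 0 c -> is_bottcher 5 0 c (psi c)) ->
  ~ injective_on (outsideM 5 0) (fun c => psi c c).
Proof.
  intros Hpsi Hinj. destruct bounded_imaginary_orbit as (a & Ha & Hy).
  set (c := (a, b) : C).
  pose proof (segment_admissible a Ha) as Hc. fold c in Hc.
  assert (Hc' : admissible (-1) 2 (Cconj c)).
  { apply admissible_left_2; [exact Ha|]. cbn; unfold b.
    rewrite Rabs_Ropp, Rabs_pos_eq; lra. }
  assert (HI : forall j, (2 <= j)%nat -> Rabs (Im (orbit c j)) <= 1).
  { intros j Hj. pose proof (Hy j Hj) as H. unfold yy in H. fold c in H.
    apply Rabs_le_between. unfold b in H. lra. }
  assert (E : c = Cconj c).
  { apply Hinj.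
    - apply (admissible_outsideM (-1) 2 c Hc).
    - apply (admissible_outsideM (-1) 2 _ Hc').
    - apply (shadow_real_eq psi Hpsi (-1) 2); auto.
      + intros j. symmetry. apply orbit_conj_Re_Im.
      + intros j Hj. rewrite (proj2 (orbit_conj_Re_Im c j)), Rabs_Ropp. auto. }
  apply (f_equal Im) in E. cbn in E. unfold b in E. lra.
Qed.

End Segment.

Theorem theorem1p3 (psi : C -> C -> C)
    (Hpsi : forall c : C, outsideM 5 0 c -> is_bottcher 5 0 c (psi c)) :
  let Psi := fun c : C => psi c c in
  orientation_reversing 5 0 Psi (RtoC (-1/10)) /\
  (forall U : C -> Prop,
     open U -> connected U -> (forall c, U c -> outsideM 5 0 c) ->
     U (RtoC (-1/10)) -> nbhd_infinity U ->
     has_fold 5 0 Psi U) /\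
  ~ injective_on (outsideM 5 0) Psi /\
  ~ quasiconformal (outsideM 5 0) Psi.
Proof.
  intros Psi. destruct (det_negative_at_minus_tenth psi Hpsi) as (L & HL & Hdet).
  assert (Hinj : ~ injective_on (outsideM 5 0) Psi) by exact (not_injective psi Hpsi).
  split; [|split; [|split]].
  - split; [|exists L; auto].
    apply (admissible_outsideM (-1) 3), admissible_left_3; cbn; [lra|rewrite Rabs_R0; lra].
  - intros U Ho Hconn HU HU0 [r Hr]. unfold has_fold. repeat split; auto.
    + pose proof (Rabs_pos r) as H0. pose proof (Rle_abs r) as H1.
      (* A real parameter beyond the radius [r] and at least 1. *)
      destruct (det_positive_right psi Hpsi (1 + Rabs r)) as (L' & HL' & Hdet'); [lra|].
      exists (RtoC (1 + Rabs r)), L'. repeat split; auto; try apply HL'.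
      apply Hr. rewrite Cmod_R, Rabs_pos_eq; lra.
    + exists (RtoC (-1 / 10)), L. auto.
  - exact Hinj.
  - intros (_ & (H & _) & _). contradiction.
Qed.
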